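(* Under the standing setup in the context, let $\gamma_k=\gamma_0(1+\delta k)^{-3/4}$ and $\eta_k=\eta_0(1+\delta k)^{-1}$ with $\gamma_0,\eta_0>0$ and $0<\delta\le\frac45\mu\eta_0$, and let $\bar\kappa\ge0$ be an integer such that for all $k\ge\bar\kappa$: $\eta_k(\mu+L)+\gamma_k\rho_N\le2$ and $\frac{\eta_k}{\gamma_k}\le\frac{\zeta\mu\rho_2}{\sqrt N\nabla^*L}$. Then for all $k\ge\bar\kappa$: $$\frac{1}{\sqrt N}\|\mathbf W_k-\overline{\mathbf W}_k\|_{\mathbb E}\le\frac{\sqrt5\,e}{2\sqrt\mu}\Big[\frac{\gamma_0}{\sqrt{\eta_0}}\sqrt{\Sigma^{(1)}}+\sqrt{\eta_0\Sigma^{(2)}}(1+\delta k)^{-1/4}\Big](1+\delta k)^{-1/4},$$ $$\frac{1}{\sqrt N}\|\overline{\mathbf W}_k-\mathbf W_k^*\|_{\mathbb E}\le\mathrm{dm}(\mathcal W)\Big(1+\frac{\delta(k-\bar\kappa)}{1+\delta\bar\kappa}\Big)^{-5/4}+\frac{\nabla^*L}{\mu\rho_2}\frac e4\frac{\eta_0}{\gamma_0}\Big(1+\frac{L^2}{\mu\rho_2}\frac{\eta_0}{\gamma_0}(1+\delta k)^{-1/4}\Big)(1+\delta k)^{-1/4},$$ $$\frac{1}{\sqrt N}\|\mathbf W_k^*-\mathbf W^*\|\le\frac{\nabla^*L}{\mu\rho_2}\frac{\eta_0}{\gamma_0}(1+\delta k)^{-1/4}.$$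
   Context: Standing setup. Let $N\ge2$, $d\ge1$. For $i=1,\dots,N$, $f_i:\mathbb R^d\to\mathbb R$ is $\mu$-strongly convex and $L$-smooth (gradient $L$-Lipschitz), $0<\mu\le L$. Let $F(\mathbf w)=\frac1N\sum_i f_i(\mathbf w)$ with unique minimizer $\mathbf w^*\in\mathbb R^d$. Let $\mathcal W\subset\mathbb R^d$ be nonempty, closed, convex, bounded with $\mathbf w^*\in\mathrm{int}(\mathcal W)$; $\zeta\triangleq\min_{\mathbf w\in\mathrm{bd}(\mathcal W)}\|\mathbf w-\mathbf w^*\|>0$; $\mathrm{dm}(\mathcal W)\triangleq\max_{\mathbf w,\mathbf w'\in\mathcal W}\|\mathbf w-\mathbf w'\|$; $\nabla^*\triangleq\max_i\|\nabla f_i(\mathbf w^* )\|$. Let $\mathbf L\in\mathbb R^{N\times N}$ be a Laplacian matrix: symmetric, off-diagonal entries $\le0$, $\mathbf L\mathbf 1_N=\mathbf 0$; its eigenvalues are $0=\rho_1\le\rho_2\le\dots\le\rho_N$, and $\rho_2>0$. Set $\hat{\mathbf L}=\mathbf L\otimes\mathbf I_d$. For $\mathbf W=[\mathbf w_1^\top,\dots,\mathbf w_N^\top]^\top\in\mathbb R^{Nd}$ let $f(\mathbf W)=\sum_i f_i(\mathbf w_i)$, and $\mathbf W^*=\mathbf 1_N\otimes\mathbf w^*$. $\Pi^N$ denotes Euclidean projection onto $\mathcal W^N$. Given stepsizes $\eta_k,\gamma_k>0$, define $G_k(\mathbf W)=f(\mathbf W)+\frac{\gamma_k}{2\eta_k}\mathbf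 W^\top\hat{\mathbf L}\mathbf W$ and $\mathbf W_k^*=\arg\min_{\mathbf W\in\mathcal W^N}G_k(\mathbf W)$. On a probability space with filtration $(\mathcal F_k)$, fix an integer $\bar\kappa\ge0$ and an $\mathcal F_{\bar\kappa}$-measurable $\mathbf W_{\bar\kappa}\in\mathcal W^N$, and define for $k\ge\bar\kappa$ $$\mathbf W_{k+1}=\Pi^N\big[\mathbf W_k-\eta_k\nabla G_k(\mathbf W_k)+\gamma_k\boldsymbol\epsilon_k^{(1)}-\eta_k\boldsymbol\epsilon_k^{(2)}\big],$$ where $\boldsymbol\epsilon_k^{(1)},\boldsymbol\epsilon_k^{(2)}\in\mathbb R^{Nd}$ are $\mathcal F_{k+1}$-measurable with $\mathbb E[\boldsymbol\epsilon_k^{(1)}|\mathcal F_k]=\mathbb E[\boldsymbol\epsilon_k^{(2)}|\mathcal F_k]=\mathbf 0$, $\mathbb E[\langle\boldsymbol\epsilon_k^{(1)},\boldsymbol\epsilon_k^{(2)}\rangle|\mathcal F_k]=0$, and $\frac1N\mathbb E[\|\boldsymbol\epsilon_k^{(1)}\|^2|\mathcal F_k]\le\Sigma^{(1)}$, $\frac1N\mathbb E[\|\boldsymbol\epsilon_k^{(2)}\|^2|\mathcal F_k]\le\Sigma^{(2)}$ for constants $\Sigma^{(1)},\Sigma^{(2)}\ge0$. The noise-free dynamics are $\overline{\mathbf W}_{\bar\kappa}=\mathbf W_{\bar\kappa}$, $\overline{\mathbf W}_{k+1}=\Pi^N[\overline{\mathbf W}_k-\eta_k\nabla G_k(\overline{\mathbf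 W}_k)]$ for $k\ge\bar\kappa$. For a random vector $\mathbf a$, $\|\mathbf a\|_{\mathbb E}\triangleq\sqrt{\mathbb E\|\mathbf a\|^2}$. *)

(* Defs.v *)
From HB Require Import structures.
From mathcomp Require Import all_boot all_order all_algebra.
From mathcomp Require Import all_classical all_reals all_analysis.
Set Implicit Arguments. Unset Strict Implicit. Unset Printing Implicit Defensive.
Import Order.TTheory GRing.Theory Num.Theory.
Import numFieldNormedType.Exports.
Local Open Scope classical_set_scope.
Local Open Scope ring_scope.

Section Defs.
Variable R : realType.

Definition vdot (d : nat) (x y : 'rV[R]_d) : R := \sum_(j < d) x 0 j * y 0 j.
Definition vnorm (d : nat) (x : 'rV[R]_d) : R := Num.sqrt (vdot x x).

(* Stacked vectors W in R^{Nd} are represented as N x d matrices whose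
   i-th row is w_i.  Euclidean norm on R^{Nd} = Frobenius norm. *)
Definition mdot (N d : nat) (X Y : 'M[R]_(N, d)) : R :=
  \sum_(i < N) \sum_(j < d) X i j * Y i j.
Definition mnorm (N d : nat) (X : 'M[R]_(N, d)) : R := Num.sqrt (mdot X X).

Definition is_gradient (d : nat) (f : 'rV[R]_d -> R) (g : 'rV[R]_d -> 'rV[R]_d) :=
  forall x v, is_derive x v f (vdot (g x) v).

Definition strongly_convex (d : nat) (mu : R) (f : 'rV[R]_d -> R)
  (g : 'rV[R]_d -> 'rV[R]_d) :=
  forall x y, f x + vdot (g x) (y - x) + mu / 2 * (vnorm (y - x)) ^+ 2 <= f y.

Definition smooth (d : nat) (L : R) (g : 'rV[R]_d -> 'rV[R]_d) :=
  forall x y, vnorm (g x - g y) <= L * vnorm (x - y).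

Definition convexW_set (d : nat) (S : set 'rV[R]_d) :=
  forall x y t, S x -> S y -> 0 <= t <= 1 -> S (t *: x + (1 - t) *: y).

Definition boundedW_set (d : nat) (S : set 'rV[R]_d) :=
  exists M : R, forall x, S x -> vnorm x <= M.

Definition bdry (d : nat) (S : set 'rV[R]_d) := closure S `\` S°.

Definition setN (N d : nat) (S : set 'rV[R]_d) : set 'M[R]_(N, d) :=
  [set X | forall i : 'I_N, S (row i X)].

Definition is_proj (N d : nat) (S : set 'M[R]_(N, d)) (P : 'M[R]_(N, d) -> 'M[R]_(N, d)) :=
  forall X, S (P X) /\ forall Y, S Y -> mnorm (X - P X) <= mnorm (X - Y).

Definition laplacian (N : nat) (L : 'M[R]_N) :=
  L^T = L /\ (forall i j : 'I_N, i != j -> L i j <= 0) /\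
  L *m (const_mx 1 : 'cV[R]_N) = 0.

Definition sorted_eigenvalues (N : nat) (L : 'M[R]_N) (rho : seq R) :=
  [/\ size rho = N, sorted <=%R rho &
      char_poly L = \prod_(r <- rho) ('X - r%:P)].

Definition fsum (N d : nat) (f : 'I_N -> 'rV[R]_d -> R) (X : 'M[R]_(N, d)) : R :=
  \sum_(i < N) f i (row i X).
Definition gradf (N d : nat) (g : 'I_N -> 'rV[R]_d -> 'rV[R]_d) (X : 'M[R]_(N, d))
  : 'M[R]_(N, d) := \matrix_(i, j) g i (row i X) 0 j.

(* G_k(W) = f(W) + gamma/(2 eta) W^T (L (x) I_d) W and its gradient *)
Definition Gk (N d : nat) (f : 'I_N -> 'rV[R]_d -> R) (L : 'M[R]_N) (eta gam : R)
  (X : 'M[R]_(N, d)) : R := fsum f X + gam / (2 * eta) * \tr (X^T *m (L *m X)).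
Definition gradGk (N d : nat) (g : 'I_N -> 'rV[R]_d -> 'rV[R]_d) (L : 'M[R]_N)
  (eta gam : R) (X : 'M[R]_(N, d)) : 'M[R]_(N, d) :=
  gradf g X + (gam / eta) *: (L *m X).

Definition maxgrad (N d : nat) (g : 'I_N -> 'rV[R]_d -> 'rV[R]_d) (w : 'rV[R]_d) : R :=
  \big[Num.max/0]_(i < N) vnorm (g i w).

Definition sched (c0 delta p : R) (k : nat) : R := c0 * (1 + delta * k%:R) `^ p.

Definition stack (N d : nat) (w : 'rV[R]_d) : 'M[R]_(N, d) := \matrix_(i < N, j < d) w 0 j.

End Defs.

Section Prob.
Variables (dO : measure_display) (O : measurableType dO) (R : realType)
  (P : probability O R).
Local Open Scope ereal_scope.

Definition meas_wrt (N d : nat) (G : set (set O)) (X : O -> 'M[R]_(N, d)) :=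
  forall (i : 'I_N) (j : 'I_d) (B : set R), measurable B ->
    G ((fun w => X w i j) @^-1` B).

(* E[X | G] = 0, written through the defining property of conditional expectation *)
Definition cond_mean_zero (N d : nat) (G : set (set O)) (X : O -> 'M[R]_(N, d)) :=
  forall (i : 'I_N) (j : 'I_d),
    P.-integrable setT (fun w => (X w i j)%:E) /\
    forall A, G A -> \int[P]_(w in A) (X w i j)%:E = 0.

Definition cond_mean_zero_real (G : set (set O)) (Y : O -> R) :=
  P.-integrable setT (fun w => (Y w)%:E) /\
  forall A, G A -> \int[P]_(w in A) (Y w)%:E = 0.

(* E[Y | G] <= c a.s. for a nonnegative real random variable Y *)
Definition cond_mean_le (G : set (set O)) (Y : O -> R) (c : R) :=
  forall A, G A -> \int[P]_(w in A) (Y w)%:E <= c%:E * P A.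

Definition Esq (N d : nat) (X : O -> 'M[R]_(N, d)) : \bar R :=
  \int[P]_w ((mnorm (X w)) ^+ 2)%:E.

End Prob.

(* Main.v *)
(* Write [a = eta / gam] for the stepsize ratio.  A zero of [gradGk] solves
   [a gradf W + Lap W = 0], and [gradf W] then sums to zero over the agents.
   Comparing two such zeros, the spectral gap bounds the disagreement part of
   [W - W'] by [|a - a'| |gradf W'| / rho_2], and strong convexity bounds
   [W - W'] by [L / mu] times its disagreement part.  Taking [a' = 0] and
   [W' = W*] gives the distance to consensus; it is at most [zeta], so the
   unconstrained zero lies in [W^N] and is the constrained minimizer.  Taking
   consecutive stepsizes gives the drift of the minimizers.

   Since [eta (mu + L) + gam rho_N <= 2], the projected gradient map is a
   [(1 - eta mu)]-contraction.  Iterating it along the drifting minimizers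
   gives the noise-free tracking bound; for the coupled noisy and noise-free
   iterates all cross terms vanish in expectation, so the mean square error
   obeys [v' <= (1 - eta mu)^2 v + gam^2 Sig1 + eta^2 Sig2].  Both recursions
   are closed by Bernoulli's inequality for [r = (1 + delta k)^(-1/4)], in
   terms of which [eta = eta0 r^4], [gam = gam0 r^3] and [a = (eta0 / gam0) r]. *)
Require Import Defs.
From HB Require Import structures.
From mathcomp Require Import all_boot all_order all_algebra.
From mathcomp Require Import all_classical all_reals all_analysis.
From mathcomp Require Import measurable_realfun.
From mathcomp Require Import ring lra.
From mathcomp Require complex.
Import Order.TTheory GRing.Theory Num.Theory.
Import numFieldNormedType.Exports.
Local Open Scope classical_set_scope.
Local Open Scope ring_scope.
Set Implicit Arguments. Unset Strict Implicit. Unset Printing Implicit Defensive.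

(** * Frobenius geometry and strongly convex smooth functions *)

Ltac mxring := apply/matrixP => ? ?; rewrite !mxE; ring.

Section Frobenius.
Context {R : realType}.

Section MatrixInner.
Context {N d : nat}.
Implicit Types X Y Z : 'M[R]_(N, d).

Lemma mdotC X Y : mdot X Y = mdot Y X.
Proof. by apply: eq_bigr => i _; apply: eq_bigr => j _; rewrite mulrC. Qed.

Lemma mdotDl X Y Z : mdot (X + Y) Z = mdot X Z + mdot Y Z.
Proof.
rewrite -big_split; apply: eq_bigr => i _ /=; rewrite -big_split.
by apply: eq_bigr => j _ /=; rewrite mxE mulrDl.
Qed.

Lemma mdotZl a X Y : mdot (a *: X) Y = a * mdot X Y.
Proof.
rewrite mulr_sumr; apply: eq_bigr => i _ /=; rewrite mulr_sumr.
by apply: eq_bigr => j _ /=; rewrite mxE mulrA.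
Qed.

Lemma mdotDr X Y Z : mdot X (Y + Z) = mdot X Y + mdot X Z.
Proof. by rewrite mdotC mdotDl !(mdotC X). Qed.

Lemma mdotZr a X Y : mdot X (a *: Y) = a * mdot X Y.
Proof. by rewrite mdotC mdotZl mdotC. Qed.

Lemma mdotNl X Y : mdot (- X) Y = - mdot X Y.
Proof. by rewrite -scaleN1r mdotZl mulN1r. Qed.

Lemma mdotNr X Y : mdot X (- Y) = - mdot X Y.
Proof. by rewrite mdotC mdotNl mdotC. Qed.

Lemma mdot0l X : mdot 0 X = 0.
Proof. by rewrite -(scale0r 0) mdotZl mul0r. Qed.

Definition mdotE := (mdotDl, mdotDr, mdotNl, mdotNr, mdotZl, mdotZr).

Lemma mdot_ge0 X : 0 <= mdot X X.
Proof. by apply: sumr_ge0 => i _; apply: sumr_ge0 => j _; rewrite -expr2 sqr_ge0. Qed.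

Lemma mdot_eq0 X : mdot X X = 0 -> X = 0.
Proof.
have sq0 i j : 0 <= X i j * X i j by rewrite -expr2 sqr_ge0.
move=> /psumr_eq0P h; apply/matrixP => i j; rewrite mxE.
have /psumr_eq0P h1 := h (fun i _ => sumr_ge0 _ (fun j _ => sq0 i j)) i isT.
by apply/eqP; rewrite -sqrf_eq0 expr2; apply/eqP/h1.
Qed.

Lemma mnorm_ge0 X : 0 <= mnorm X.
Proof. exact: sqrtr_ge0. Qed.

Lemma mnorm_sqr X : mnorm X ^+ 2 = mdot X X.
Proof. by rewrite sqr_sqrtr // mdot_ge0. Qed.

Lemma mnorm_eq0 X : mnorm X = 0 -> X = 0.
Proof. by move=> h; apply: mdot_eq0; rewrite -mnorm_sqr h expr0n. Qed.

Lemma mnormZ a X : mnorm (a *: X) = `|a| * mnorm X.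
Proof. by rewrite /mnorm !mdotE mulrA -expr2 sqrtrM ?sqr_ge0// sqrtr_sqr. Qed.

Lemma mnormN X : mnorm (- X) = mnorm X.
Proof. by rewrite -scaleN1r mnormZ normrN1 mul1r. Qed.

Lemma mnormBC X Y : mnorm (X - Y) = mnorm (Y - X).
Proof. by rewrite -mnormN opprB. Qed.

(** Cauchy-Schwarz: with [x], [y] the two norms and [c] the inner product, the squared norm of
    [mdot X Y *: X - mdot X X *: Y] equals [x^2 (x^2 y^2 - c^2)], and it is nonnegative. *)
Lemma mdot_le X Y : mdot X Y <= mnorm X * mnorm Y.
Proof.
have [->|X0] := eqVneq X 0; first by rewrite mdot0l mulr_ge0 ?mnorm_ge0.
have x0 : 0 < mnorm X.
  by rewrite lt_neqAle mnorm_ge0 andbT eq_sym; apply: contra_neq X0 => /mnorm_eq0.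
have := mdot_ge0 (mdot X Y *: X - mdot X X *: Y).
rewrite !mdotE (mdotC Y X) -!mnorm_sqr.
set c := mdot X Y; set x := mnorm X; set y := mnorm Y => h.
have {}h : 0 <= (x ^+ 2) * ((x * y) ^+ 2 - c ^+ 2) by nra.
have {}h : c ^+ 2 <= (x * y) ^+ 2.
  by rewrite -subr_ge0; rewrite pmulr_rge0 ?exprn_gt0 in h.
have xy0 : 0 <= x * y by rewrite mulr_ge0 ?mnorm_ge0.
rewrite (le_trans (ler_norm _))// -(ler_pXn2r (ltn0Sn 1)) ?nnegrE//.
by rewrite real_normK ?num_real.
Qed.

Lemma mnormD X Y : mnorm (X + Y) <= mnorm X + mnorm Y.
Proof.
rewrite -(ler_pXn2r (ltn0Sn 1)) ?nnegrE ?addr_ge0 ?mnorm_ge0//.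
rewrite mnorm_sqr !mdotE (mdotC Y X) -!mnorm_sqr.
by have := mdot_le X Y; nra.
Qed.

Lemma mnorm_tri X Y Z : mnorm (X - Z) <= mnorm (X - Y) + mnorm (Y - Z).
Proof. by rewrite (le_trans _ (mnormD _ _))// addrA subrK. Qed.

Lemma mnorm_leP X c : 0 <= c -> mdot X X <= c ^+ 2 -> mnorm X <= c.
Proof. by move=> c0 /ler_wsqrtr; rewrite sqrtr_sqr ger0_norm. Qed.

Lemma coord_le_mnorm X i j : `|X i j| <= mnorm X.
Proof.
rewrite -(sqrtr_sqr (X i j)) ler_wsqrtr// /mdot (bigD1 i)//= (bigD1 j)//=.
rewrite -expr2 -addrA lerDl addr_ge0//.
  by apply: sumr_ge0 => k _; rewrite -expr2 sqr_ge0.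
by apply: sumr_ge0 => l _; apply: sumr_ge0 => k _; rewrite -expr2 sqr_ge0.
Qed.

End MatrixInner.

Section Rows.
Context {N d : nat}.
Implicit Types X Y : 'M[R]_(N, d).

Lemma vdotE : @vdot R d = @mdot R 1 d.
Proof. by apply/funext => x; apply/funext => y; rewrite /mdot big_ord1. Qed.

Lemma vnormE : @vnorm R d = @mnorm R 1 d.
Proof. by apply/funext => x; rewrite /vnorm vdotE. Qed.

Lemma mdot_rows X Y : mdot X Y = \sum_(i < N) vdot (row i X) (row i Y).
Proof. by apply: eq_bigr => i _; apply: eq_bigr => j _; rewrite !mxE. Qed.

Lemma row_le_mnorm X i : vnorm (row i X) <= mnorm X.
Proof.
apply: ler_wsqrtr; rewrite mdot_rows (bigD1 i)//= lerDl.
by apply: sumr_ge0 => k _; rewrite vdotE mdot_ge0.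
Qed.

Lemma mnorm_rows X c : 0 <= c -> (forall i, vnorm (row i X) <= c) ->
  mnorm X <= Num.sqrt N%:R * c.
Proof.
move=> c0 h; apply: mnorm_leP; first by rewrite mulr_ge0 ?sqrtr_ge0.
rewrite exprMn sqr_sqrtr ?ler0n// mdot_rows.
rewrite (_ : _ * _ = \sum_(i < N) c ^+ 2); last first.
  by rewrite sumr_const card_ord mulr_natl.
apply: ler_sum => i _; rewrite vdotE -mnorm_sqr -vnormE.
by rewrite lerXn2r ?nnegrE ?sqrtr_ge0.
Qed.

End Rows.

(** * Quadratic bounds, cocoercivity and contraction of the gradient step *)

Section QuadraticBounds.
Context {N d : nat}.
Implicit Types (X Y Z D : 'M[R]_(N, d)) (G : 'M[R]_(N, d) -> R)
  (g : 'M[R]_(N, d) -> 'M[R]_(N, d)).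

(** Strong convexity and, in the next definition, smoothness as inequalities on a pair [G], [g]. In
    this form they carry over to the penalized objective by adding a quadratic form. *)
Definition quad_lower m G g := forall X Y,
  G X + mdot (g X) (Y - X) + m / 2 * mdot (Y - X) (Y - X) <= G Y.

Definition quad_upper M G g := forall X Y,
  G Y <= G X + mdot (g X) (Y - X) + M / 2 * mdot (Y - X) (Y - X).

Lemma quad_lower_monotone m G g X Y : quad_lower m G g ->
  m * mdot (X - Y) (X - Y) <= mdot (g X - g Y) (X - Y).
Proof.
move=> h; have := h X Y; have := h Y X.
rewrite -(opprB X Y) !(mdotDl (g X)) !mdotNl !mdotNr opprK; lra.
Qed.

(* The bounds are used at the points [Y - a / (M - m)] and [X + a / (M - m)],
   where [a = g Y - g X - m (Y - X)]. *)
Lemma cocoercive m M G g X Y : m < M -> quad_lower m G g -> quad_upper M G g ->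
  forall a, a = g Y - g X - m *: (Y - X) ->
  mdot a a <= (M - m) * mdot a (Y - X).
Proof.
move=> mM hl hu a aE; have [D DE] : exists D, D = Y - X by exists (Y - X).
rewrite -DE in aE *; have gE : g Y = g X + a + m *: D by rewrite aE; mxring.
set t := (M - m)^-1.
have t0 : 0 < t by rewrite invr_gt0 subr_gt0.
have tM : t * (M - m) = 1 by rewrite mulVf// gt_eqF// subr_gt0.
have h1 := le_trans (hl X (Y - t *: a)) (hu Y (Y - t *: a)).
have h2 := le_trans (hl Y (X + t *: a)) (hu X (X + t *: a)).
have e1 : Y - t *: a - X = D - t *: a by rewrite DE; mxring.
have e2 : Y - t *: a - Y = - (t *: a) by mxring.
have e3 : X + t *: a - Y = t *: a - D by rewrite DE; mxring.
have e4 : X + t *: a - X = t *: a by mxring.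
rewrite e1 e2 gE in h1; rewrite e3 e4 gE in h2.
move: h1 h2; rewrite !mdotE (mdotC D a) => h1 h2.
(* The two inequalities are added: the values of [G] and the terms in [mdot D D] cancel. *)
have h : t * (mdot a a * (2 - t * (M - m))) <= mdot a D.
  nra.
rewrite tM in h.
have -> : mdot a a = (t * (M - m)) * mdot a a by rewrite tM mul1r.
rewrite (_ : t * _ * _ = (M - m) * (t * (mdot a a * (2 - 1)))); last by ring.
by rewrite ler_pM2l// subr_gt0.
Qed.

(** With [D = Y - X], [z = 1 - eta m] and [a] the gradient difference minus [m D], the two steps
    differ by [eta a - z D]. In its squared norm the terms containing [a] add up to at most zero by
    cocoercivity, provided [eta (M - m) <= 2 z], which is the stepsize condition. *)
Lemma gradient_step_contraction m M eta G g X Y : m < M -> 0 <= eta -> 0 <= m ->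
  eta * (m + M) <= 2 -> quad_lower m G g -> quad_upper M G g ->
  mnorm ((X - eta *: g X) - (Y - eta *: g Y)) <= (1 - eta * m) * mnorm (X - Y).
Proof.
move=> mM eta0 m0 hs hl hu.
have [a aE] : exists a, a = g Y - g X - m *: (Y - X) by eexists.
have ha := cocoercive mM hl hu aE.
set z := 1 - eta * m; have z0 : 0 <= z by rewrite /z; nra.
apply: mnorm_leP; first by rewrite mulr_ge0 ?mnorm_ge0.
have [D DE] : exists D, D = Y - X by exists (Y - X).
have -> : X - eta *: g X - (Y - eta *: g Y) = eta *: a - z *: D.
  by rewrite aE DE /z; mxring.
rewrite exprMn mnormBC mnorm_sqr -DE !mdotE (mdotC D a); rewrite -DE in ha.
have : 0 <= mdot a a by exact: mdot_ge0.
set b := mdot a D in ha *; set aa := mdot a a in ha * => aa0.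
suff : eta * aa <= 2 * z * b.
  move=> h.
  have : 0 <= eta * (2 * z * b - eta * aa) by rewrite mulr_ge0// subr_ge0.
  lra.
have Mm : 0 < M - m by rewrite subr_gt0.
rewrite -(ler_pM2l Mm); apply: (@le_trans _ _ (2 * z * aa)); last first.
  rewrite (_ : (M - m) * _ = 2 * z * ((M - m) * b)); last by ring.
  by rewrite ler_wpM2l// mulr_ge0.
rewrite mulrA ler_wpM2r// /z; lra.
Qed.

End QuadraticBounds.
End Frobenius.

(** * Spectral bounds for the Laplacian *)

Section Spectrum.
Context {R : realType}.
Import complex.
Local Notation C := R[i].
Local Notation inj := (real_complex R).
Local Open Scope sesquilinear_scope.

Lemma map_real_conj m n (A : 'M[R]_(m, n)) : (map_mx inj A) ^t* = (map_mx inj A)^T.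
Proof.
by apply/matrixP => i j; rewrite !mxE; apply/CrealP; rewrite complex_real.
Qed.

Lemma map_real_realmx m n (A : 'M[R]_(m, n)) : map_mx inj A \is a realmx.
Proof. by apply/mxOverP => i j; rewrite mxE complex_real. Qed.

(** The spectral theorem is applied over the complex numbers, where a real symmetric matrix is
    hermitian and has real eigenvalues. Comparing characteristic polynomials identifies them with
    the entries of [rho], counted with multiplicity. *)
Lemma symmetric_diagonalization n (A : 'M[R]_n) (rho : seq R) :
  A^T = A -> char_poly A = \prod_(r <- rho) ('X - r%:P) ->
  exists (U : 'M[C]_n) (e : 'I_n -> R), [/\ U \is unitarymx,
    perm_eq (codom e) rho &
    map_mx inj A = U ^t* *m diag_mx (\row_i inj (e i)) *m U].
Proof.
move=> Asym Achar; set B := map_mx inj A.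
have Bsym : B \is symmetricmx.
  apply/is_hermitianmxP; rewrite expr0 scale1r map_mx_id//.
  by rewrite /B map_trmx Asym.
have Bherm : B \is hermsymmx by exact: realsym_hermsym (map_real_realmx _).
have Bn := hermitian_normalmx Bherm.
have dreal := hermitian_spectral_diag_real Bherm.
have /orthomx_spectralP := Bn.
have Uu := spectral_unitarymx B.
set U := spectralmx B in Uu *; set d := spectral_diag B in dreal *.
rewrite invmx_unitary// => BE.
have /choice[e eE] : forall i, exists r : R, d 0 i = inj r.
  by move=> i; have /mxOverP /(_ 0 i) /complex_realP := dreal.
have dE : d = \row_i inj (e i) by apply/rowP => i; rewrite mxE eE.
exists U, e; split => //; last by rewrite -dE.
have : char_poly B = \prod_(i < n) ('X - (d 0 i)%:P).
  have -> : char_poly B = char_poly (diag_mx d).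
    have UU : U *m U ^t* = 1%:M by apply/unitarymxP.
    rewrite /char_poly /char_poly_mx.
    have -> : 'X%:M - map_mx polyC B =
        map_mx polyC (U ^t*) *m ('X%:M - map_mx polyC (diag_mx d)) *m map_mx polyC U.
      rewrite mulmxBr mulmxBl -!map_mxM -BE.
      rewrite scalar_mxC -mulmxA -map_mxM.
      by rewrite (mulmx1C UU) map_mx1 mulmx1.
    rewrite !det_mulmx mulrAC -det_mulmx -map_mxM (mulmx1C UU).
    by rewrite map_mx1 det1 mul1r.
  rewrite char_poly_trig ?diag_mx_is_trig//.
  by apply: eq_bigr => i _; rewrite mxE eqxx mulr1n.
rewrite -map_char_poly Achar rmorph_prod /=.
under eq_bigr do rewrite map_polyXsubC.
under [RHS]eq_bigr do rewrite eE.
move=> h.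
(* Equal products of monic linear factors have the same roots with multiplicity; real parts bring
   the permutation back to the reals. *)
have : \prod_(x <- map inj rho) ('X - x%:P) = \prod_(x <- map inj (codom e)) ('X - x%:P).
  by rewrite big_map h big_map big_image.
move/prod_XsubC_eq; rewrite perm_sym => /(perm_map (@Re R)).
have injK : cancel inj (@Re R) by [].
by rewrite !(mapK injK).
Qed.

(** [c v i] is the squared modulus of the [i]-th coordinate of [v] in a unitary eigenbasis. For the
    last clause, a kernel vector has no component along eigenvectors with nonzero eigenvalue, so [u]
    lies along the [i]-th one and orthogonality removes the weight of [v] there. *)
Lemma rayleigh_weights n (A : 'M[R]_n) (rho : seq R) :
  A^T = A -> char_poly A = \prod_(r <- rho) ('X - r%:P) ->
  exists (e : 'I_n -> R) (c : 'cV[R]_n -> 'I_n -> R),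
  [/\ perm_eq (codom e) rho,
    forall v, [/\ forall i, 0 <= c v i, mdot v v = \sum_i c v i &
       mdot v (A *m v) = \sum_i e i * c v i] &
    forall u v, u != 0 -> A *m u = 0 -> mdot u v = 0 ->
      forall i, (forall k, k != i -> e k != 0) -> c v i = 0].
Proof.
move=> Asym Achar.
have [U [e [Uu eP AE]]] := symmetric_diagonalization Asym Achar.
have UU : U ^t* *m U = 1%:M by apply: mulmx1C; apply/unitarymxP.
pose y (v : 'cV[R]_n) := U *m map_mx inj v.
have mdotE' (u v : 'cV[R]_n) : inj (mdot u v) = ((map_mx inj u)^T *m map_mx inj v) 0 0.
  rewrite /mdot mxE rmorph_sum /=; apply: eq_bigr => i _.
  by rewrite big_ord1 rmorphM !mxE.
have dotE u v : inj (mdot u v) = \sum_i (y u i 0)^* * y v i 0.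
  rewrite mdotE' -map_real_conj -[map_mx inj v]mul1mx -UU -mulmxA mulmxA.
  by rewrite -map_mxM -trmx_mul mxE; apply: eq_bigr => i _; rewrite !mxE.
have yA v i : y (A *m v) i 0 = inj (e i) * y v i 0.
  rewrite /y map_mxM AE -!mulmxA mulmxA (unitarymxP Uu) mul1mx.
  by rewrite mul_diag_mx !mxE.
exists e, (fun v i => Re (y v i 0) ^+ 2 + Im (y v i 0) ^+ 2); split => //.
- have ccE v i : inj (Re (y v i 0) ^+ 2 + Im (y v i 0) ^+ 2) = (y v i 0)^* * y v i 0.
    by rewrite add_Re2_Im2 sqr_normc mulrC.
  move=> v; split => [i||]; first by rewrite addr_ge0 ?sqr_ge0.
  + apply: (@complexI R); rewrite dotE rmorph_sum; apply: eq_bigr => i _.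
    exact/esym/ccE.
  + apply: (@complexI R); rewrite dotE rmorph_sum; apply: eq_bigr => i _.
    by rewrite yA mulrCA -ccE -rmorphM.
move=> u v u0 Au uv i ei.
have yu k : k != i -> y u k 0 = 0.
  move=> /ei ek; have := yA u k; rewrite Au /y map_mx0 mulmx0 mxE.
  move=> /esym/eqP; rewrite mulf_eq0 => /orP[|/eqP//].
  by rewrite (inj_eq (@complexI R) _ 0) (negbTE ek).
have yui : y u i 0 != 0.
  apply: contraNneq u0 => h; apply/eqP/mdot_eq0/(@complexI R); rewrite dotE big1// => k _.
  by have [->|/yu->] := eqVneq k i; rewrite ?h mulr0.
have := dotE u v; rewrite uv (bigD1 i)//= big1 ?addr0; last first.
  by move=> k /yu ->; rewrite conjC0 mul0r.
move=> /esym/eqP; rewrite mulf_eq0 conjC_eq0 (negbTE yui) /= => /eqP ->.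
by rewrite /= expr0n addr0.
Qed.

End Spectrum.

(** * The consensus space, the spectral gap and comparison of penalized zeros *)

Section Consensus.
Context {R : realType} {N d : nat}.
Implicit Types X Y Z D : 'M[R]_(N, d).

Lemma mdot_mulmxl m (A : 'M[R]_(N, m)) (X : 'M[R]_(m, d)) Y :
  mdot (A *m X) Y = mdot X (A^T *m Y).
Proof.
have tr p (U V : 'M[R]_(p, d)) : mdot U V = \tr (U *m V^T).
  by apply: eq_bigr => i _; rewrite mxE; apply: eq_bigr => j _; rewrite !mxE.
by rewrite !tr trmx_mul trmxK -mulmxA mxtrace_mulC mulmxA.
Qed.

Lemma mdot_cols X Y : mdot X Y = \sum_(j < d) mdot (col j X) (col j Y).
Proof.
rewrite /mdot exchange_big; apply: eq_bigr => j _; apply: eq_bigr => i _.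
by rewrite big_ord1 !mxE.
Qed.

(** Orthogonality to the consensus matrices [stack N w]: the rows sum to zero. *)
Definition colsum0 Z := (const_mx 1 : 'rV[R]_N) *m Z = 0.

Definition rowmean Z : 'rV[R]_d := N%:R^-1 *: ((const_mx 1 : 'rV[R]_N) *m Z).

Lemma stackE (w : 'rV[R]_d) : stack N w = (const_mx 1 : 'cV[R]_N) *m w.
Proof. by apply/matrixP => i j; rewrite !mxE big_ord1 !mxE mul1r. Qed.

Lemma row_stack (w : 'rV[R]_d) i : row i (stack N w) = w.
Proof. by apply/rowP => j; rewrite !mxE. Qed.

Lemma mdot_stack (w : 'rV[R]_d) Z : colsum0 Z -> mdot (stack N w) Z = 0.
Proof.
by move=> hZ; rewrite stackE mdot_mulmxl trmx_const hZ mdotC mdot0l.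
Qed.

Lemma colsum0_disagreement Z : (0 < N)%N -> colsum0 (Z - stack N (rowmean Z)).
Proof.
move=> N0; rewrite /colsum0 stackE mulmxBr mulmxA.
have -> : (const_mx 1 : 'rV[R]_N) *m (const_mx 1 : 'cV[R]_N) = N%:R%:M.
  apply/matrixP => i j; rewrite !ord1 !mxE eqxx mulr1n.
  by under eq_bigr do rewrite !mxE mul1r; rewrite sumr_const card_ord.
by rewrite mul_scalar_mx scalerA divff ?scale1r ?subrr// pnatr_eq0 -lt0n.
Qed.

Section Laplacian.
Context {Lap : 'M[R]_N} {rho : seq R}.
Hypotheses (N2 : (2 <= N)%N) (hLap : laplacian Lap) (hrho : sorted_eigenvalues Lap rho)
  (rho1 : 0 < rho`_1).

Lemma laplacian_tr : Lap^T = Lap. Proof. by case: hLap. Qed.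

Lemma laplacian_stack (w : 'rV[R]_d) : Lap *m stack N w = 0.
Proof. by case: hLap => _ [_ h]; rewrite stackE mulmxA h mul0mx. Qed.

Lemma colsum0_laplacian Z : colsum0 (Lap *m Z).
Proof.
rewrite /colsum0 mulmxA -(trmxK (const_mx 1 *m Lap)) trmx_mul laplacian_tr trmx_const.
by case: hLap => _ [_ ->]; rewrite trmx0 mul0mx.
Qed.

Lemma mdot_laplacianC X Y : mdot X (Lap *m Y) = mdot (Lap *m X) Y.
Proof. by rewrite mdot_mulmxl laplacian_tr. Qed.

(** [e] lists [rho] in an unknown order. Taking [i0] to be one index that carries the head of [rho],
    the remaining indices list exactly the tail, even if the head is repeated there. *)
Lemma eigenvalue_bounds (e : 'I_N -> R) : perm_eq (codom e) rho ->
  (forall i, e i <= rho`_N.-1) /\ exists i0, forall k, k != i0 -> rho`_1 <= e k.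
Proof.
move=> ep; case: hrho => rs rsort _; split.
  move=> i; have : e i \in rho by rewrite -(perm_mem ep) codom_f.
  case/(nthP 0) => k; rewrite rs => kN <-.
  have N0 : (0 < N)%N by apply: leq_trans N2.
  apply: (sorted_leq_nth le_trans le_refl 0) => //; rewrite ?inE ?rs ?prednK//.
  by rewrite -ltnS prednK.
case: rho rs rsort ep => [|r0 r]; first by move=> /= N0; exfalso; move: N2; rewrite -N0.
move=> /= rs rsort ep.
have : r0 \in codom e by rewrite (perm_mem ep) mem_head.
case/codomP => i0 r0E; exists i0 => k ki0.
have : e k \in r.
  have : perm_eq (r0 :: r) (map e (i0 :: rem i0 (enum 'I_N))).
    rewrite perm_sym; apply: perm_trans ep; rewrite codomE.
    by rewrite perm_sym; apply: perm_map; apply: perm_to_rem; rewrite mem_enum.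
  rewrite /= r0E perm_cons => /perm_mem ->; apply: map_f.
  by rewrite mem_rem_uniq ?enum_uniq// inE ki0 mem_enum.
case/(nthP 0) => j jr <-.
have := sorted_leq_nth le_trans le_refl 0 (path_sorted rsort).
by apply; rewrite ?inE // (leq_trans _ jr).
Qed.

Lemma laplacian_le Z : mdot Z (Lap *m Z) <= rho`_N.-1 * mdot Z Z.
Proof.
case: hrho => _ _ /(rayleigh_weights laplacian_tr)[e [c [/eigenvalue_bounds[eN _] cE _]]].
rewrite !(mdot_cols Z) mulr_sumr; apply: ler_sum => j _.
have -> : col j (Lap *m Z) = Lap *m col j Z by rewrite !colE mulmxA.
case: (cE (col j Z)) => c0 -> ->.
by rewrite mulr_sumr; apply: ler_sum => i _; rewrite ler_wpM2r.
Qed.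

(** Each column of [Z] is orthogonal to the constant vector, a kernel vector of [Lap], so its weight
    at the smallest eigenvalue vanishes; all other eigenvalues are at least the second one. *)
Lemma laplacian_gap Z : colsum0 Z -> rho`_1 * mdot Z Z <= mdot Z (Lap *m Z).
Proof.
move=> Z0.
case: hrho => _ _ /(rayleigh_weights laplacian_tr)[e [c [/eigenvalue_bounds[_ [i0 e1]] cE c0]]].
rewrite !(mdot_cols Z) mulr_sumr; apply: ler_sum => j _.
have -> : col j (Lap *m Z) = Lap *m col j Z by rewrite !colE mulmxA.
have ci0 : c (col j Z) i0 = 0.
  apply: (c0 (const_mx 1)).
  - apply/eqP => /matrixP /(_ (Ordinal (ltnW N2)) 0); rewrite !mxE.
    by apply/eqP; rewrite oner_eq0.
  - by case: hLap => _ [].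
  - move/matrixP: Z0 => /(_ 0 j); rewrite !mxE => <-.
    by apply: eq_bigr => i _; rewrite big_ord1 !mxE.
  - by move=> k /e1 h; rewrite gt_eqF// (lt_le_trans rho1).
case: (cE (col j Z)) => cp -> ->.
rewrite mulr_sumr; apply: ler_sum => i _.
by have [->|/e1 ?] := eqVneq i i0; rewrite ?ci0 ?mulr0// ler_wpM2r.
Qed.

Lemma mdot_disagreement D (w : 'rV[R]_d) :
  mdot D (Lap *m D) = mdot (D - stack N w) (Lap *m (D - stack N w)).
Proof.
rewrite mulmxBr laplacian_stack subr0 mdotDl mdotNl.
by rewrite (mdot_stack _ (colsum0_laplacian _)) subr0.
Qed.

(** The quadratic form does not see the row mean; after its removal the spectral gap applies. *)
Lemma laplacian_ge0 Z : 0 <= mdot Z (Lap *m Z).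
Proof.
rewrite (mdot_disagreement _ (rowmean Z)).
apply: le_trans (laplacian_gap (colsum0_disagreement _ (ltnW N2))).
by rewrite mulr_ge0 ?mdot_ge0// ltW.
Qed.

Lemma rho_last_gt0 : 0 < rho`_N.-1.
Proof.
case: hrho => rs rsort _; apply: lt_le_trans rho1 _.
have N0 : (0 < N)%N by apply: leq_trans N2.
apply: (sorted_leq_nth le_trans le_refl 0 rsort); rewrite ?inE ?rs ?prednK//.
by rewrite -ltnS prednK.
Qed.

(* Both gradients sum to zero over the agents, so the consensus part of
   [W - W'] is controlled by the disagreement part [Dp], and [Dp] by the
   spectral gap. *)
Lemma penalized_zeros_dist (gf : 'M[R]_(N, d) -> 'M[R]_(N, d)) mu L a a' W W' :
  0 < mu -> 0 < L -> 0 <= a ->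
  (forall X Y, mu * mdot (X - Y) (X - Y) <= mdot (gf X - gf Y) (X - Y)) ->
  (forall X Y, mnorm (gf X - gf Y) <= L * mnorm (X - Y)) ->
  a *: gf W + Lap *m W = 0 -> a' *: gf W' + Lap *m W' = 0 ->
  colsum0 (gf W) -> colsum0 (gf W') ->
  mnorm (W - W') <= L / (mu * rho`_1) * `|a - a'| * mnorm (gf W').
Proof.
move=> mu0 L0 a0 hm hl e e' s s'.
have [D DE] : exists D, D = W - W' by eexists.
have [m mE] : exists m, m = rowmean D by eexists.
have [Dp DpE] : exists Dp, Dp = D - stack N m by eexists.
have DpE' : D = stack N m + Dp by rewrite DpE addrC subrK.
have sp : colsum0 Dp by rewrite DpE mE; apply/colsum0_disagreement/ltnW.
have g1 := hm W W'; rewrite -DE in g1.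
have g2 := hl W W'; rewrite -DE in g2.
have g3 := laplacian_gap sp.
have LD : Lap *m Dp = a' *: gf W' - a *: gf W.
  rewrite DpE mulmxBr laplacian_stack subr0 DE mulmxBr.
  by apply/eqP; rewrite eq_sym subr_eq addrAC -subr_eq opprK e' addrC e.
have st (Z : 'M[R]_(N, d)) : colsum0 Z -> mdot Z D = mdot Z Dp.
  by move=> sZ; rewrite DpE' mdotDr (mdotC Z) mdot_stack// add0r.
have g4 : mdot (gf W - gf W') D = mdot (gf W - gf W') Dp.
  by apply: st; rewrite /colsum0 mulmxBr s s' subr0.
(* The difference of the two zero equations is tested with [Dp]. Monotonicity makes the term with
   [a *: (gf W - gf W')] nonpositive, leaving only the change of the ratio. *)
have g5 : rho`_1 * mdot Dp Dp <= - (a - a') * mdot (gf W') Dp.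
  apply: (le_trans g3); rewrite LD mdotC.
  have -> : a' *: gf W' - a *: gf W = - (a - a') *: gf W' - a *: (gf W - gf W').
    by mxring.
  rewrite mdotDl mdotNl !mdotZl gerBl mulr_ge0// -g4 (le_trans _ g1)//.
  by rewrite mulr_ge0 ?mdot_ge0// ltW.
have g6 : rho`_1 * mnorm Dp <= `|a - a'| * mnorm (gf W').
  have [->|h] := eqVneq (mnorm Dp) 0; first by rewrite mulr0 mulr_ge0 ?mnorm_ge0.
  have Dp0 : 0 < mnorm Dp by rewrite lt_neqAle eq_sym h mnorm_ge0.
  rewrite -(ler_pM2r Dp0) -mulrA -expr2 mnorm_sqr (le_trans g5)//.
  rewrite (le_trans (ler_norm _))// normrM normrN -mulrA ler_wpM2l//.
  rewrite ler_norml mdot_le andbT.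
  by rewrite -lerN2 opprK -mdotNl (le_trans (mdot_le _ _))// mnormN.
(* Strong monotonicity in [D] is played against the Lipschitz bound, using that the gradient
   difference pairs with [D] only through [Dp]. *)
have g7 : mu * mnorm D <= L * mnorm Dp.
  have [->|h] := eqVneq (mnorm D) 0; first by rewrite mulr0 mulr_ge0 ?mnorm_ge0// ltW.
  have D0 : 0 < mnorm D by rewrite lt_neqAle eq_sym h mnorm_ge0.
  rewrite -(ler_pM2r D0) -mulrA -expr2 mnorm_sqr (le_trans g1)// g4.
  by rewrite (le_trans (mdot_le _ _))// mulrAC ler_wpM2r ?mnorm_ge0.
rewrite -DE -!mulrA [_^-1 * _]mulrC !mulrA ler_pdivlMr ?mulr_gt0//.
have : mu * mnorm D * rho`_1 <= L * (`|a - a'| * mnorm (gf W')).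
  rewrite (le_trans (_ : _ <= L * (rho`_1 * mnorm Dp)))//.
    by rewrite mulrCA mulrC ler_wpM2l// ltW.
  by rewrite ler_wpM2l// ltW.
nra.
Qed.

End Laplacian.
End Consensus.

(** * Smoothness, fixed points and boundary distance *)

(** Plays the role of letting [n] tend to infinity, by the Archimedean property. *)
Lemma ler_addinv (R : realType) (a b c : R) :
  (forall n, a <= b + c / n.+1%:R) -> a <= b.
Proof.
move=> h; apply/ler_addgt0Pr => e e0.
have [c0|c0] := leP c 0.
  rewrite (le_trans (h 0%N))// lerD2l divr1; lra.
apply: (le_trans (h (Num.bound (c / e)))); rewrite lerD2l.
rewrite ler_pdivrMr ?ltr0n// mulrC -ler_pdivrMr//.
rewrite (le_trans (ltW (archi_boundP _)))// ?ler_nat//.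
by rewrite divr_ge0// ltW.
Qed.

(** Lets matrices be used as a complete normed space, so that absolutely convergent series of
    matrices converge. *)
HB.instance Definition _ (R : realType) m n := Complete.on 'M[R]_(m, n).

Section Smoothness.
Context {R : realType} {N d : nat}.
Implicit Types (X Y : 'M[R]_(N, d)) (G : 'M[R]_(N, d) -> R)
  (g : 'M[R]_(N, d) -> 'M[R]_(N, d)).

(* Summing the convexity inequality over [n] equal pieces of the segment
   from [X] to [Y] gives the bound with [L / 2] replaced by [L (n + 1) / (2 n)]. *)
Lemma lipschitz_quad_upper m L G g : 0 <= m -> 0 <= L -> quad_lower m G g ->
  (forall X Y, mnorm (g X - g Y) <= L * mnorm (X - Y)) -> quad_upper L G g.
Proof.
move=> m0 L0 hl hg X Y.
have [H HE] : exists H, H = Y - X by eexists.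
rewrite -HE; apply: (@ler_addinv _ _ _ (L / 2 * mdot H H)) => n.
pose t : R := n.+1%:R^-1.
have t0 : 0 < t by rewrite invr_gt0 ltr0n.
have key j : G (X + (j%:R * t) *: H) <=
    G X + (j%:R * t) * mdot (g X) H + L * t ^+ 2 * (j%:R * (j%:R + 1) / 2) * mdot H H.
  elim: j => [|j IH]; first by rewrite !mul0r scale0r addr0 mulr0 mul0r !addr0.
  pose U := X + (j%:R * t) *: H; pose V := X + (j.+1%:R * t) *: H.
  have VU : U - V = - t *: H.
    by rewrite /U /V -natr1; mxring.
  (* Convexity is used from the far end [V] of the piece back to [U], which bounds [G V] from above
     in terms of the gradient at [V]. *)
  have := hl V U; rewrite VU !mdotE.
  have VX : V - X = (j.+1%:R * t) *: H by rewrite addrAC subrr add0r.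
  have h1 : mdot (g V - g X) H <= L * (j.+1%:R * t) * mdot H H.
    rewrite (le_trans (mdot_le _ _))// -mnorm_sqr expr2 mulrA ler_wpM2r ?mnorm_ge0//.
    rewrite (le_trans (hg _ _))// VX mnormZ ger0_norm ?mulrA//.
    by rewrite mulr_ge0 ?ler0n// ltW.
  rewrite mdotDl mdotNl in h1.
  have h2 : 0 <= m / 2 * (t * (t * mdot H H)).
    by rewrite !mulr_ge0// ?mdot_ge0 ?ltW.
  have h3 : t * mdot (g V) H <= t * mdot (g X) H + t * (L * (j.+1%:R * t) * mdot H H).
    by rewrite -mulrDr (ler_wpM2l (ltW t0))// -lerBlDl.
  move: IH; rewrite -/U -/V -natr1 in h3 *.
  lra.
have := key n.+1; rewrite {1 2}/t mulfV ?pnatr_eq0// scale1r HE addrC subrK -HE mul1r.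
have -> : L * t ^+ 2 * (n.+1%:R * (n.+1%:R + 1) / 2) * mdot H H =
    L / 2 * mdot H H + L / 2 * mdot H H / n.+1%:R.
  have : n.+1%:R != 0 :> R by rewrite pnatr_eq0.
  by rewrite /t; set k := n.+1%:R => k0; field.
by rewrite addrA.
Qed.

(** The norm that carries the topology is the largest absolute entry; this lemma and the next make
    it equivalent to the Frobenius norm. *)
Lemma mnorm_le_norm X : mnorm X <= Num.sqrt (N * d)%:R * `|X|.
Proof.
apply: mnorm_leP; first by rewrite mulr_ge0 ?sqrtr_ge0.
rewrite exprMn sqr_sqrtr ?ler0n//.
have -> : (N * d)%:R * `|X| ^+ 2 = \sum_(i < N) \sum_(j < d) `|X| ^+ 2.
  by rewrite !sumr_const !card_ord -mulrnA mulnC mulr_natl.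
apply: ler_sum => i _; apply: ler_sum => j _.
rewrite -expr2 -real_normK ?num_real// lerXn2r ?nnegrE//.
rewrite [leRHS]/Num.Def.normr/= mx_normrE; apply/bigmax_geP; right => /=.
by exists (i, j).
Qed.

Lemma norm_le_mnorm X : `|X| <= mnorm X.
Proof.
rewrite [leLHS]/Num.Def.normr/= mx_normrE; apply/bigmax_leP; split => [|[i j] _].
  exact: mnorm_ge0.
exact: coord_le_mnorm.
Qed.

(** Banach's argument in the Frobenius norm: the increments of the iterates from [0] decay
    geometrically, so their telescoping series converges absolutely, and the limit is fixed. *)
Lemma contraction_fixpoint (T : 'M[R]_(N, d) -> 'M[R]_(N, d)) q : 0 <= q -> q < 1 ->
  (forall X Y, mnorm (T X - T Y) <= q * mnorm (X - Y)) -> exists X, T X = X.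
Proof.
move=> q0 q1 hT; pose x n := iter n T 0.
have dx n : mnorm (x n.+1 - x n) <= mnorm (x 1%N - x 0%N) * q ^+ n.
  elim: n => [|n IH]; first by rewrite expr0 mulr1.
  rewrite exprSr mulrA mulrC (le_trans (hT _ _))//.
  by rewrite mulrC [leRHS]mulrC ler_wpM2l.
have cvx : cvgn x.
  have -> : x = cst (x 0%N) \+ series (telescope x).
    by apply/funext => n; rewrite telescopeK /= addrC subrK.
  apply: is_cvgD; first exact: is_cvg_cst.
  apply: normed_cvg.
  apply: (@series_le_cvg _ _ (geometric (mnorm (x 1%N - x 0%N)) q)).
  - by move=> n; exact: normr_ge0.
  - by move=> n; rewrite /= mulr_ge0 ?mnorm_ge0 ?exprn_ge0.
  - by move=> n; exact: le_trans (norm_le_mnorm _) (dx n).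
  - by apply: is_cvg_geometric_series; rewrite ger0_norm.
exists (limn x); apply/eqP; rewrite -subr_eq0; apply/eqP/mnorm_eq0/eqP.
rewrite eq_le mnorm_ge0 andbT.
pose s : R := Num.sqrt (N * d)%:R; have s0 : 0 <= s by exact: sqrtr_ge0.
apply/ler_addgt0Pr => e e0; rewrite add0r.
(* Chosen so that the factor [s] between the norms leaves at most [e / 2]; the [+ 1] covers [s = 0],
   when a dimension is zero. *)
have e'0 : 0 < e / (2 * (s + 1)) by rewrite divr_gt0// mulr_gt0// ltr_wpDl.
move: cvx => /cvgrPdist_le /(_ _ e'0) [m _ hm].
have close n : (m <= n)%N -> mnorm (limn x - x n) <= e / 2.
  move=> /hm /= h; rewrite (le_trans (mnorm_le_norm _))//.
  rewrite (le_trans (ler_wpM2l s0 h))// mulrCA ler_pM2l//.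
  by rewrite ler_pdivrMr ?mulr_gt0 ?ltr_wpDl//; lra.
apply: (le_trans (mnorm_tri _ (x m.+1) _)).
have h1 := close m (leqnn _); have h2 := close m.+1 (leqnSn _).
have h3 := hT (limn x) (x m).
rewrite (mnormBC (x m.+1)).
have := mnorm_ge0 (limn x - x m) => h4.
rewrite /= in h2 *; nra.
Qed.

End Smoothness.

(** If [w] were outside, the last point of [S] on the segment from [c] to [w] would be a boundary
    point at distance [s |w - c|] with [s < 1]. This is below [z] unless [w = c], which lies in
    [S]. *)
Lemma ball_sub_of_bdry (R : realType) d (S : set 'rV[R]_d) (c : 'rV[R]_d) z :
  closed S -> S c -> (forall w, bdry S w -> z <= vnorm (w - c)) ->
  forall w, vnorm (w - c) <= z -> S w.
Proof.
move=> Scl Sc hz w wz; apply: contrapT => Sw.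
pose p (t : R) := c + t *: (w - c).
have pc : continuous p.
  by move=> t; apply: cvgD; [exact: cvg_cst | apply: cvgZr_tmp; exact: cvg_id].
pose E := [set t : R | 0 <= t <= 1 /\ S (p t)].
have E0 : E 0 by split; rewrite ?lexx ?ler01// /p scale0r addr0.
have Eub : has_sup E.
  by split; [exists 0 | exists 1 => t [/andP[]]].
set s := sup E.
have s0 : 0 <= s by exact: sup_upper_bound.
have s1 : s <= 1 by apply: sup_le_ub; [exists 0 | move=> t [/andP[]]].
have cls : closure S (p s).
  move=> B /pc /nbhs_ballP[e /= e0 eB].
  have [t Et st] := sup_adherent e0 Eub.
  exists (p t); split; first by case: Et.
  apply: eB; rewrite /ball /= ltr_norml.
  have : t <= s by exact: sup_upper_bound.
  rewrite -/s in st; lra.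
have Sps : S (p s) by move: cls; rewrite -(proj1 (closure_id _) Scl).
have s1' : s < 1.
  rewrite lt_neqAle s1 andbT; apply: contra_notN Sw => /eqP s1E.
  by move: Sps; rewrite /p s1E scale1r addrC subrK.
have : bdry S (p s).
  split => // /pc /nbhs_ballP[e /= e0 eS].
  (* If [p s] were interior, a parameter beyond [s] would still give a point of [S], against the
     supremum. The minimum keeps it at most [1], and [s < 1] makes it exceed [s]. *)
  pose t := Num.min (s + e / 2) 1.
  have st : s < t by rewrite lt_min s1' andbT ltrDl divr_gt0.
  suff : t <= s by lra.
  apply: sup_upper_bound => //; split.
    by rewrite (le_trans s0 (ltW st)) ge_min lexx orbT.
  apply: eS; rewrite /ball /= ltr_norml.
  have : t <= s + e / 2 by rewrite ge_min lexx.
  lra.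
move=> /hz; rewrite /p addrAC subrr add0r vnormE mnormZ ger0_norm//.
rewrite vnormE in wz.
have h := mnorm_ge0 (w - c) => zle.
have : mnorm (w - c) = 0 by nra.
move=> /mnorm_eq0/eqP; rewrite subr_eq0 => /eqP wc.
by apply: Sw; rewrite wc.
Qed.

(** * Projections and the penalized objective *)

Section Projection.
Context {R : realType} {N d : nat} {S : set 'rV[R]_d}
  {Pi : 'M[R]_(N, d) -> 'M[R]_(N, d)}.
Hypotheses (Scv : convexW_set S) (hPi : is_proj (setN S) Pi).
Implicit Types X Y : 'M[R]_(N, d).

(** Moving from [Pi X] towards [Y] by a fraction [t = 1 / (n + 1)] stays in the convex set, so
    minimality gives [2 <E, D> <= t |D|^2]; then [n] grows. *)
Lemma proj_variational X Y : setN S Y -> mdot (X - Pi X) (Y - Pi X) <= 0.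
Proof.
move=> SY; have [SP hP] := hPi X.
set D := Y - Pi X; set E := X - Pi X.
apply: (@ler_addinv _ _ _ (mdot D D / 2)) => n; rewrite add0r.
pose t : R := n.+1%:R^-1.
have t0 : 0 < t by rewrite invr_gt0 ltr0n.
have t1 : t <= 1 by rewrite invf_le1 ?ltr0n// ler1n.
have SZ : setN S (t *: Y + (1 - t) *: Pi X).
  move=> i; rewrite linearD !linearZ /=; apply: Scv => //.
  by rewrite (ltW t0).
have := hP _ SZ; rewrite -/E.
have -> : X - (t *: Y + (1 - t) *: Pi X) = E - t *: D by rewrite /E /D; mxring.
rewrite -(ler_pXn2r (ltn0Sn 1)) ?nnegrE ?mnorm_ge0// !mnorm_sqr.
move: D E => D E; rewrite !mdotE (mdotC D E) -/t => h.
have : 0 <= t * (t * mdot D D - 2 * mdot E D) by lra.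
by rewrite pmulr_rge0//; lra.
Qed.

(** Adding the variational inequalities at both points gives
    [|Pi X - Pi Y|^2 <= <X - Y, Pi X - Pi Y>], and Cauchy-Schwarz finishes. *)
Lemma proj_nonexpansive X Y : mnorm (Pi X - Pi Y) <= mnorm (X - Y).
Proof.
have := proj_variational X (proj1 (hPi Y)).
have := proj_variational Y (proj1 (hPi X)).
have : mdot (X - Y) (Pi X - Pi Y) <= mnorm (X - Y) * mnorm (Pi X - Pi Y) by exact: mdot_le.
have := mnorm_sqr (Pi X - Pi Y).
have := mnorm_ge0 (Pi X - Pi Y); have := mnorm_ge0 (X - Y).
set p := mnorm (Pi X - _); set q := mnorm _.
move: (Pi X) (Pi Y) => x y.
rewrite !mdotE (mdotC y x) (mdotC Y x) (mdotC Y y) (mdotC X y) (mdotC X x).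
by move=> q0 p0 pE h1 h2 h3; nra.
Qed.

Lemma proj_id X : setN S X -> Pi X = X.
Proof.
move=> SX; have [_ /(_ _ SX)] := hPi X.
rewrite subrr {2}/mnorm mdot0l sqrtr0 => h.
have /mnorm_eq0/eqP : mnorm (X - Pi X) = 0 by apply/eqP; rewrite eq_le h mnorm_ge0.
by rewrite subr_eq0 => /eqP.
Qed.

End Projection.

(** * The sum of the local functions, and zeros of the penalized gradient *)

Section Objective.
Context {R : realType} {N d : nat} {f : 'I_N -> 'rV[R]_d -> R}
  {g : 'I_N -> 'rV[R]_d -> 'rV[R]_d} {mu L : R}.
Hypotheses (mu0 : 0 < mu) (muL : mu <= L)
  (hsc : forall i, strongly_convex mu (f i) (g i)) (hsm : forall i, smooth L (g i)).
Implicit Types X Y Z : 'M[R]_(N, d).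

Let L0 : 0 < L. Proof. exact: lt_le_trans muL. Qed.

Lemma row_gradf X i : row i (gradf g X) = g i (row i X).
Proof. by apply/rowP => j; rewrite !mxE. Qed.

Lemma gradf_lipschitz X Y : mnorm (gradf g X - gradf g Y) <= L * mnorm (X - Y).
Proof.
apply: mnorm_leP; first by rewrite mulr_ge0 ?mnorm_ge0// ltW.
rewrite exprMn mnorm_sqr !mdot_rows mulr_sumr; apply: ler_sum => i _.
rewrite !linearB /= !row_gradf vdotE -!mnorm_sqr -exprMn -vnormE.
by rewrite lerXn2r ?nnegrE ?mulr_ge0 ?(ltW L0)// ?vnormE ?mnorm_ge0// -vnormE hsm.
Qed.

Lemma fsum_lower : quad_lower mu (fsum f) (gradf g).
Proof.
move=> X Y; rewrite !mdot_rows mulr_sumr -!big_split; apply: ler_sum => i _ /=.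
rewrite row_gradf !linearB /=; have := hsc i (row i X) (row i Y).
by rewrite vnormE mnorm_sqr vdotE.
Qed.

Lemma fsum_upper : quad_upper L (fsum f) (gradf g).
Proof.
by apply: (lipschitz_quad_upper (ltW mu0) (ltW L0) fsum_lower); exact: gradf_lipschitz.
Qed.

(** Let [v] be the sum of the local gradients at [w0]. Along consensus directions the sum of the
    [f i] has smoothness constant [N L], so a step of length [t = 1 / (N L)] against [v] lowers it
    by at least [t |v|^2 / 2]; minimality forces [v = 0]. *)
Lemma gradf_sum0 (w0 : 'rV[R]_d) :
  (forall w, (\sum_(i < N) f i w0) / N%:R <= (\sum_(i < N) f i w) / N%:R) ->
  (0 < N)%N -> colsum0 (gradf g (stack N w0)).
Proof.
move=> hmin N0; pose v := (const_mx 1 : 'rV[R]_N) *m gradf g (stack N w0).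
have N0' : 0 < N%:R :> R by rewrite ltr0n.
pose t : R := (N%:R * L)^-1.
have t0 : 0 < t by rewrite invr_gt0 mulr_gt0.
have fs w : fsum f (stack N w) = \sum_(i < N) f i w.
  by apply: eq_bigr => i _; rewrite row_stack.
have := hmin (w0 - t *: v); rewrite ler_pM2r ?invr_gt0// -!fs => h1.
have := le_trans h1 (fsum_upper (stack N w0) _).
have -> : stack N (w0 - t *: v) - stack N w0 = - (t *: stack N v).
  by mxring.
rewrite !mdotE (mdotC (gradf _ _)).
have sv (u : 'rV[R]_d) Z : mdot (stack N u) Z = mdot u ((const_mx 1 : 'rV[R]_N) *m Z).
  by rewrite stackE mdot_mulmxl trmx_const.
rewrite sv -/v sv.
have -> : (const_mx 1 : 'rV[R]_N) *m stack N v = N%:R *: v.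
  rewrite stackE mulmxA; apply/matrixP => i j; rewrite !mxE big_ord1 !mxE.
  by under eq_bigr do rewrite !mxE mul1r; rewrite sumr_const card_ord !ord1.
rewrite mdotZr => h2; rewrite /colsum0 -/v; apply: mdot_eq0; apply/eqP.
rewrite eq_le mdot_ge0 andbT.
have tN : t * (N%:R * L) = 1 by rewrite mulVf// mulf_neq0// gt_eqF.
have : 0 <= - (t * mdot v v) + (t * (N%:R * L)) * t * mdot v v / 2 by lra.
by rewrite tN => h3; have := mdot_ge0 v; nra.
Qed.

Lemma gradf_consensus_le (w : 'rV[R]_d) :
  mnorm (gradf g (stack N w)) <= Num.sqrt N%:R * maxgrad g w.
Proof.
apply: mnorm_rows; first by apply/bigmax_geP; left.
by move=> i; rewrite row_gradf row_stack; apply: le_bigmax.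
Qed.

Section Penalized.
Context {Lap : 'M[R]_N} {rho : seq R}.
Hypotheses (N2 : (2 <= N)%N) (hLap : laplacian Lap) (hrho : sorted_eigenvalues Lap rho)
  (rho1 : 0 < rho`_1).

Let rhoN := rho_last_gt0 N2 hrho rho1.

Section Stepsizes.
Context {eta gam : R}.
Hypotheses (eta0 : 0 < eta) (gam0 : 0 < gam).
Local Notation G := (Gk f Lap eta gam).
Local Notation dG := (gradGk g Lap eta gam).

Let b0 : 0 < gam / eta. Proof. exact: divr_gt0. Qed.

(** The first-order remainder of the penalized objective is that of [fsum f] plus a Laplacian form
    of the increment. Bounding this form below by zero and above by the largest eigenvalue gives the
    next two lemmas. *)
Lemma Gk_expand X Y :
  G Y - G X - mdot (dG X) (Y - X) =
  fsum f Y - fsum f X - mdot (gradf g X) (Y - X)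
  + gam / eta / 2 * mdot (Y - X) (Lap *m (Y - X)).
Proof.
have tr U V : \tr (U^T *m V) = mdot U V.
  rewrite /mdot exchange_big; apply: eq_bigr => j _; rewrite mxE.
  by apply: eq_bigr => i _; rewrite mxE.
rewrite /Gk /gradGk !tr invfM [_ / 2]mulrC (mulrC 2^-1).
have e1 : mdot X (Lap *m Y) = mdot Y (Lap *m X).
  by rewrite (mdot_laplacianC hLap) mdotC.
rewrite mulmxBr !mdotE !(mdotC (Lap *m X)) e1; field.
exact: lt0r_neq0.
Qed.

Lemma Gk_lower : quad_lower mu G dG.
Proof.
move=> X Y; have := Gk_expand X Y; have := fsum_lower X Y.
have := laplacian_ge0 N2 hLap hrho rho1 (Y - X) => h1.
have : 0 <= gam / eta / 2 * mdot (Y - X) (Lap *m (Y - X)).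
  by rewrite !mulr_ge0 ?(ltW gam0)// invr_ge0 ltW.
lra.
Qed.

Lemma Gk_upper : quad_upper (L + gam / eta * rho`_N.-1) G dG.
Proof.
move=> X Y; have := Gk_expand X Y; have := fsum_upper X Y.
have := ler_wpM2l (ltW b0) (laplacian_le N2 hLap hrho (Y - X)).
lra.
Qed.

(** For the upper constant [M] of [Gk_upper], [eta * (mu + M)] is exactly the left side of the
    stepsize condition. A positive largest eigenvalue gives [mu < M] even if [mu = L]. *)
Lemma gradient_map_contraction X Y : eta * (mu + L) + gam * rho`_N.-1 <= 2 ->
  mnorm ((X - eta *: dG X) - (Y - eta *: dG Y)) <= (1 - eta * mu) * mnorm (X - Y).
Proof.
move=> h; apply: (gradient_step_contraction X Y _ (ltW eta0) (ltW mu0) _ Gk_lower Gk_upper).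
  by rewrite (le_lt_trans muL)// ltrDl mulr_gt0.
have -> : eta * (mu + (L + gam / eta * rho`_N.-1)) = eta * (mu + L) + gam * rho`_N.-1.
  by field; exact: lt0r_neq0.
exact: h.
Qed.

(** The gradient step of length [2 / (mu + M)] contracts the whole space, and its fixed point is a
    zero of the gradient. This length is chosen for the fixed-point argument alone. *)
Lemma gradGk_zero_ex : exists Z, dG Z = 0.
Proof.
set M := L + gam / eta * rho`_N.-1.
have mM : mu < M by rewrite (le_lt_trans muL)// ltrDl mulr_gt0.
have s0 : 0 < mu + M by rewrite addr_gt0// (lt_trans mu0).
have t0 : 0 < 2 / (mu + M) by rewrite divr_gt0.
have tE : 2 / (mu + M) * (mu + M) = 2 by rewrite divfK// gt_eqF.
have [||X Y|Z] := @contraction_fixpoint _ _ _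
  (fun X => X - (2 / (mu + M)) *: dG X) (1 - 2 / (mu + M) * mu).
- by nra.
- by rewrite gtrBl mulr_gt0.
- apply: (gradient_step_contraction X Y mM (ltW t0) (ltW mu0) _ Gk_lower Gk_upper).
  by rewrite tE.
move=> TZ; exists Z; have /eqP : (2 / (mu + M)) *: dG Z = 0.
  by rewrite -[_ *: _](subKr Z) TZ subrr.
by rewrite scaler_eq0 gt_eqF//= => /eqP.
Qed.

(** Scaling by [eta / gam] leaves an equation in the ratio only; multiplying it by the row of ones
    removes the Laplacian. *)
Lemma gradGk_zeroE Z : dG Z = 0 ->
  (eta / gam) *: gradf g Z + Lap *m Z = 0 /\ colsum0 (gradf g Z).
Proof.
move=> h; have e : (eta / gam) *: gradf g Z + Lap *m Z = 0.
  have : (eta / gam) *: dG Z = 0 by rewrite h scaler0.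
  rewrite /gradGk scalerDr scalerA mulrA divfK ?gt_eqF// divff ?gt_eqF//.
  by rewrite scale1r.
split => //; have /(congr1 (mulmx (const_mx 1 : 'rV[R]_N))) := e.
rewrite mulmxDr (colsum0_laplacian hLap) addr0 mulmx0 -scalemxAr => /eqP.
by rewrite scaler_eq0 gt_eqF ?divr_gt0//= => /eqP.
Qed.

Context {wstar : 'rV[R]_d}.
Hypothesis hwstar :
  forall w, (\sum_(i < N) f i wstar) / N%:R <= (\sum_(i < N) f i w) / N%:R.
Local Notation nab := (maxgrad g wstar).
Local Notation C := (nab * L / (mu * rho`_1)).

Let f_mono X Y : mu * mdot (X - Y) (X - Y) <= mdot (gradf g X - gradf g Y) (X - Y).
Proof. exact: quad_lower_monotone fsum_lower. Qed.

Lemma penalized_minimizer_dist Z : dG Z = 0 ->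
  mnorm (Z - stack N wstar) <= Num.sqrt N%:R * (C * (eta / gam)).
Proof.
move=> /gradGk_zeroE[e s].
have s' := gradf_sum0 hwstar (ltnW N2).
(* The consensus optimum is the zero belonging to ratio [0]. *)
have e' : 0 *: gradf g (stack N wstar) + Lap *m stack N wstar = 0.
  by rewrite scale0r add0r (laplacian_stack hLap).
have a0 : 0 < eta / gam by rewrite divr_gt0.
have := penalized_zeros_dist N2 hLap hrho rho1 mu0 L0 (ltW a0) f_mono gradf_lipschitz e e' s s'.
move=> /le_trans; apply; rewrite subr0 gtr0_norm//.
have k0 : 0 <= L / (mu * rho`_1) * (eta / gam).
  by rewrite mulr_ge0 ?(ltW a0)// divr_ge0 ?(ltW L0)// mulr_ge0 ?ltW.
apply: le_trans (ler_wpM2l k0 (gradf_consensus_le wstar)) _.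
by rewrite le_eqVlt; apply/orP; left; apply/eqP; ring.
Qed.

Lemma gradf_penalized_le Z : dG Z = 0 ->
  mnorm (gradf g Z) <= Num.sqrt N%:R * (nab * (1 + L ^+ 2 / (mu * rho`_1) * (eta / gam))).
Proof.
move=> /penalized_minimizer_dist h.
have -> : gradf g Z = gradf g (stack N wstar) + (gradf g Z - gradf g (stack N wstar)).
  by rewrite addrC subrK.
rewrite (le_trans (mnormD _ _))//.
have h1 := gradf_consensus_le wstar.
have h2 := le_trans (gradf_lipschitz Z (stack N wstar)) (ler_wpM2l (ltW L0) h).
apply: (le_trans (lerD h1 h2)).
by rewrite le_eqVlt; apply/orP; left; apply/eqP; ring.
Qed.

(** Each row of the unconstrained zero [Z0] lies within [zeta] of [wstar], so [Z0] is feasible.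
    Strong convexity at [Z0] makes it the only minimizer, hence [Z = Z0]. *)
Lemma constrained_minimizer_zero (S : set 'rV[R]_d) zeta Z : closed S -> S wstar ->
  (forall w, bdry S w -> zeta <= vnorm (w - wstar)) ->
  Num.sqrt N%:R * (C * (eta / gam)) <= zeta ->
  setN S Z -> (forall X, setN S X -> G Z <= G X) -> dG Z = 0.
Proof.
move=> Scl Sw hz hC SZ minZ; have [Z0 Z00] := gradGk_zero_ex.
have SZ0 : setN S Z0.
  move=> i; apply: (ball_sub_of_bdry Scl Sw hz).
  rewrite (le_trans _ hC)// (le_trans _ (penalized_minimizer_dist Z00))//.
  suff -> : row i Z0 - wstar = row i (Z0 - stack N wstar) by exact: row_le_mnorm.
  by rewrite linearB /= row_stack.
have := Gk_lower Z0 Z; rewrite Z00 mdot0l addr0 => h.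
have h2 := minZ _ SZ0.
suff : Z = Z0 by move=> ->.
apply/eqP; rewrite -subr_eq0; apply/eqP/mdot_eq0/eqP.
rewrite eq_le mdot_ge0 andbT -(pmulr_rle0 _ (divr_gt0 mu0 (ltr0n _ 2))).
lra.
Qed.

End Stepsizes.

(** The two ratios are compared directly. The gradient is evaluated at [Z'], so the last factor
    carries the ratio of [Z']. *)
Lemma penalized_minimizer_drift (eta gam eta' gam' : R) wstar Z Z' :
  0 < eta -> 0 < gam -> 0 < eta' -> 0 < gam' ->
  (forall w, (\sum_(i < N) f i wstar) / N%:R <= (\sum_(i < N) f i w) / N%:R) ->
  gradGk g Lap eta gam Z = 0 -> gradGk g Lap eta' gam' Z' = 0 ->
  mnorm (Z - Z') <= Num.sqrt N%:R * (maxgrad g wstar * L / (mu * rho`_1)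
     * `|eta / gam - eta' / gam'| * (1 + L ^+ 2 / (mu * rho`_1) * (eta' / gam'))).
Proof.
move=> e0 g0 e'0 g'0 hw hZ hZ'.
have [e s] := gradGk_zeroE e0 g0 hZ; have [e' s'] := gradGk_zeroE e'0 g'0 hZ'.
have a0 : 0 < eta / gam by rewrite divr_gt0.
have f_mono X Y : mu * mdot (X - Y) (X - Y) <= mdot (gradf g X - gradf g Y) (X - Y).
  exact: quad_lower_monotone fsum_lower.
have := penalized_zeros_dist N2 hLap hrho rho1 mu0 L0 (ltW a0) f_mono gradf_lipschitz e e' s s'.
move=> /le_trans; apply.
have k0 : 0 <= L / (mu * rho`_1) * `|eta / gam - eta' / gam'|.
  by rewrite mulr_ge0// divr_ge0 ?(ltW L0)// mulr_ge0 ?ltW.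
apply: le_trans (ler_wpM2l k0 (gradf_penalized_le e'0 g'0 hw hZ')) _.
by rewrite le_eqVlt; apply/orP; left; apply/eqP; ring.
Qed.

End Penalized.
End Objective.

(** * Stepsizes and scalar recursions *)

(** Both stepsizes are integer powers of this quantity, which keeps real exponents out of the
    recursions. *)
Definition decay {R : realType} (delta : R) (k : nat) : R :=
  (1 + delta * k%:R) `^ (- (1 / 4)).

Section Schedules.
Context {R : realType} {delta : R}.
Hypothesis delta0 : 0 < delta.
Local Notation r := (decay delta).

Lemma clock_gt0 k : 0 < 1 + delta * k%:R.
Proof. by rewrite ltr_pwDl// mulr_ge0// ltW. Qed.

Lemma decay_gt0 k : 0 < r k.
Proof. by rewrite powR_gt0// clock_gt0. Qed.

Lemma powR_quarter (x : R) n : 0 <= x -> x `^ (- (n%:R / 4)) = (x `^ (- (1 / 4))) ^+ n.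
Proof.
move=> x0; rewrite -powR_mulrn ?powR_ge0// -powRrM; congr (_ `^ _); by field.
Qed.

Lemma decay4 k : r k ^+ 4 = (1 + delta * k%:R)^-1.
Proof.
rewrite -powR_quarter ?(ltW (clock_gt0 k))// divff ?pnatr_eq0//.
by rewrite powR_inv1// ltW// clock_gt0.
Qed.

Lemma sched_inv c k : sched c delta (-1) k = c * r k ^+ 4.
Proof.
by rewrite /sched decay4 powR_inv1// ltW// clock_gt0.
Qed.

Lemma sched_three_quarters c k : sched c delta (- (3 / 4)) k = c * r k ^+ 3.
Proof. by rewrite /sched -powR_quarter// ltW// clock_gt0. Qed.

Lemma decay_leS k : r k.+1 <= r k.
Proof.
rewrite -(ler_pXn2r (ltn0Sn 3)) ?nnegrE ?(ltW (decay_gt0 _))// !decay4.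
rewrite lef_pV2 ?posrE ?clock_gt0// lerD2l ler_pM2l// ler_nat; exact: leqnSn.
Qed.

(* Bernoulli's inequality for the exponent [-1/4]. *)
Lemma decay_geS k : r k * (1 - delta * r k ^+ 4 / 4) <= r k.+1.
Proof.
set s := 1 + delta * k%:R; have s0 : 0 < s := clock_gt0 k.
have sE : 1 + delta * k.+1%:R = s * (1 + delta / s).
  by rewrite /s -natr1; field; rewrite gt_eqF// clock_gt0.
have x0 : 0 < delta / s by rewrite divr_gt0.
rewrite decay4 /decay sE powRM ?(ltW s0) ?addr_ge0 ?(ltW x0)//.
rewrite ler_wpM2l ?powR_ge0// -/s.
rewrite /powR gt_eqF ?addr_gt0//.
apply: (le_trans _ (expR_ge1Dx _)).
have : ln (1 + delta / s) <= delta / s by apply: le_ln1Dx; rewrite (lt_trans _ x0).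
lra.
Qed.

Lemma decay_ratio5 k kbar :
  (1 + delta * (k%:R - kbar%:R) / (1 + delta * kbar%:R)) `^ (- (5 / 4))
  = (r k / r kbar) ^+ 5.
Proof.
have sb := clock_gt0 kbar.
have -> : 1 + delta * (k%:R - kbar%:R) / (1 + delta * kbar%:R) =
    (1 + delta * k%:R) / (1 + delta * kbar%:R) by field; rewrite gt_eqF.
have q0 : 0 <= (1 + delta * k%:R) / (1 + delta * kbar%:R).
  by rewrite divr_ge0// ltW// clock_gt0.
rewrite powR_quarter//; congr (_ ^+ _).
have db : r kbar != 0 by rewrite gt_eqF ?decay_gt0.
apply: (canRL (mulfK db)).
by rewrite /decay -powRM ?(ltW sb)// divfK// gt_eqF.
Qed.

End Schedules.

(** * One-step inequalities for the tracking error and the noise error *)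

Section Recursions.
Context {R : realType} {x z r r' : R}.
(** Here [x] stands for [delta r^4] and [z] for [eta mu]. Then [xz] is the condition on [delta], and
    [rx] is Bernoulli's bound for one step of [r]. *)
Hypotheses (xz : 5 / 4 * x <= z) (z1 : z <= 1) (x0 : 0 <= x) (r0 : 0 < r) (r'0 : 0 < r')
  (rr' : r' <= r) (rx : r * (1 - x / 4) <= r').

Let x45 : x <= 4 / 5. Proof. by move: xz z1; lra. Qed.

Let bern n : r ^+ n * (1 - n%:R * (x / 4)) <= r' ^+ n.
Proof.
have y0 : 0 <= 1 - x / 4 by move: x45; lra.
apply: (@le_trans _ _ ((r * (1 - x / 4)) ^+ n)); last first.
  by rewrite lerXn2r ?nnegrE ?mulr_ge0 ?(ltW r0) ?(ltW r'0).
rewrite exprMn ler_wpM2l ?exprn_ge0 ?(ltW r0)//.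
elim: n => [|n IH]; first by rewrite mul0r subr0 expr0.
rewrite exprS (le_trans _ (ler_wpM2l y0 IH))// -natr1.
have : 0 <= n%:R * (x / 4) ^+ 2 :> R by rewrite mulr_ge0 ?ler0n ?sqr_ge0.
by rewrite expr2; lra.
Qed.

(** The contraction factor is at most [1 - 5 x / 4]. This carries [r^5] to [r'^5] for the transient
    term, and leaves room in the terms in [r] and [r^2] to absorb the drift. *)
Lemma tracking_step e dm C A kap rb a a' : 2 <= e -> 0 <= dm -> 0 <= C -> 0 <= A ->
  0 <= kap -> 0 < rb ->
  a' <= (1 - z) * a + C * `|A * r' - A * r| * (1 + kap * (A * r)) ->
  a <= dm * (r / rb) ^+ 5 + C * (e / 4) * A * (1 + kap * A * r) * r ->
  a' <= dm * (r' / rb) ^+ 5 + C * (e / 4) * A * (1 + kap * A * r') * r'.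
Proof.
move=> e2 dm0 C0 A0 kap0 rb0 h' h.
have zc0 : 0 <= 1 - z by rewrite subr_ge0.
have zx : 1 - z <= 1 - 5 * (x / 4) by move: xz; lra.
have b5 : (1 - z) * r ^+ 5 <= r' ^+ 5.
  apply: le_trans (bern 5); rewrite mulrC ler_wpM2l ?exprn_ge0 ?(ltW r0)//.
have i5 : (1 - z) * (dm * (r / rb) ^+ 5) <= dm * (r' / rb) ^+ 5.
  rewrite mulrCA ler_wpM2l// !expr_div_n mulrA ler_wpM2r//.
  by rewrite invr_ge0 exprn_ge0 ?ltW.
(* The part of the bound linear in [r] absorbs the drift [r - r'], at most [x r / 4]; [e >= 1] would
   suffice here, and [e >= 4 / 3] in [l2]. *)
have l1 : (1 - z) * (e / 4) * r + (r - r') <= e / 4 * r'.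
  have h1 : (1 - z) * (e / 4 * r) <= (1 - 5 * (x / 4)) * (e / 4 * r).
    by rewrite ler_wpM2r// mulr_ge0 ?(ltW r0)// ; lra.
  have h2 : (e / 4 + 1) * (r * (1 - x / 4)) <= (e / 4 + 1) * r'.
    by rewrite ler_wpM2l//; lra.
  have : 0 <= x * r * (e - 1) by rewrite !mulr_ge0 ?(ltW r0)//; lra.
  by move: h1 h2; lra.
have l2 : (1 - z) * (e / 4) * r ^+ 2 + (r - r') * r <= e / 4 * r' ^+ 2.
  have h1 : (1 - z) * (e / 4 * r ^+ 2) <= (1 - 5 * (x / 4)) * (e / 4 * r ^+ 2).
    by rewrite ler_wpM2r// mulr_ge0 ?sqr_ge0//; lra.
  have h2 : e / 4 * (r ^+ 2 * (1 - 2 * (x / 4))) <= e / 4 * r' ^+ 2.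
    by rewrite ler_wpM2l ?(bern 2)//; lra.
  have h3 : (r - r') * r <= x / 4 * r ^+ 2.
    by rewrite expr2 mulrA ler_wpM2r ?(ltW r0)//; move: rx; lra.
  have : 0 <= x * r ^+ 2 * (3 * e - 4).
    by apply: mulr_ge0; [apply: mulr_ge0 => //; exact: sqr_ge0 | lra].
  by move: h1 h2 h3; lra.
have nE : `|A * r' - A * r| = A * (r - r').
  by rewrite -mulrBr normrM ger0_norm// ler0_norm ?opprB// subr_le0.
rewrite nE in h'.
apply: (le_trans h'); apply: (le_trans (lerD (ler_wpM2l zc0 h) (lexx _))).
have CA0 : 0 <= C * A by rewrite mulr_ge0.
have j1 := ler_wpM2l CA0 l1.
have j2 := ler_wpM2l (mulr_ge0 CA0 (mulr_ge0 kap0 A0)) l2.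
by move: i5 j1 j2; rewrite !expr2; lra.
Qed.

(** Since [e >= 2], the constant [K] is at least [5 / mu], so the fresh noise costs at most a share
    [z / 5] of the bound. The two noise sources decay as [r^2] and [r^4], and one argument for [r^n]
    with [n <= 4] serves both. *)
Lemma noise_step e mu eta0 gam0 S1 S2 v v' : 2 <= e -> 0 < mu -> 0 < eta0 ->
  0 <= S1 -> 0 <= S2 -> z = eta0 * r ^+ 4 * mu ->
  v' <= (1 - z) ^+ 2 * v + ((gam0 * r ^+ 3) ^+ 2 * S1 + (eta0 * r ^+ 4) ^+ 2 * S2) ->
  v <= 5 * e ^+ 2 / (4 * mu) * (gam0 ^+ 2 / eta0 * S1 * r ^+ 2 + eta0 * S2 * r ^+ 4) ->
  v' <= 5 * e ^+ 2 / (4 * mu) * (gam0 ^+ 2 / eta0 * S1 * r' ^+ 2 + eta0 * S2 * r' ^+ 4).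
Proof.
move=> e2 mu0 eta00 S10 S20 zE h' h.
set K := 5 * e ^+ 2 / (4 * mu) in h *.
have K5 : 5 / mu <= K.
  have -> : K = 5 / mu * (e ^+ 2 / 4) by rewrite /K; field; rewrite gt_eqF.
  by rewrite ler_peMr ?divr_ge0 ?(ltW mu0)// expr2; nra.
have K0 : 0 <= K by apply: le_trans K5; rewrite divr_ge0// ltW.
have Kz : eta0 * r ^+ 4 <= K * z / 5.
  have -> : eta0 * r ^+ 4 = 5 / mu * z / 5 by rewrite zE; field; rewrite gt_eqF.
  by rewrite ler_wpM2r// ler_wpM2r//; move: x0 xz; lra.
(* By [z <= 1] the left side is at most [1 - 4 z / 5], and [x <= 4 z / 5]; the constant [4/5] of the
   condition on [delta] is used exactly. *)
have zz : (1 - z) ^+ 2 + z / 5 <= 1 - x by move: x0 xz z1; rewrite expr2; nra.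
have gen n : (n <= 4)%N ->
    (1 - z) ^+ 2 * K * r ^+ n + eta0 * r ^+ 4 * r ^+ n <= K * r' ^+ n.
  move=> n4; have rn0 : 0 <= r ^+ n by rewrite exprn_ge0 ?ltW.
  apply: (le_trans _ (ler_wpM2l K0 (bern n))).
  have h1 := ler_wpM2r rn0 Kz.
  have h2 := ler_wpM2l (mulr_ge0 K0 rn0) zz.
  have h3 : K * r ^+ n * (1 - x) <= K * r ^+ n * (1 - n%:R * (x / 4)).
    rewrite (ler_wpM2l (mulr_ge0 K0 rn0))//.
    have : n%:R <= 4 :> R by rewrite ler_nat.
    by move: x0 => ? ?; nra.
  by move: h1 h2 h3; lra.
apply: (le_trans h'); apply: (le_trans (lerD (ler_wpM2l (sqr_ge0 (1 - z)) h) (lexx _))).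
have V1 : 0 <= gam0 ^+ 2 / eta0 * S1 by rewrite mulr_ge0// divr_ge0 ?sqr_ge0// ltW.
have V2 : 0 <= eta0 * S2 by rewrite mulr_ge0// ltW.
have j1 := ler_wpM2l V1 (gen 2 isT); have j2 := ler_wpM2l V2 (gen 4 isT).
have e1 : (gam0 * r ^+ 3) ^+ 2 * S1 = gam0 ^+ 2 / eta0 * S1 * (eta0 * r ^+ 4 * r ^+ 2).
  by field; rewrite gt_eqF.
have e3 : (eta0 * r ^+ 4) ^+ 2 * S2 = eta0 * S2 * (eta0 * r ^+ 4 * r ^+ 4) by ring.
by rewrite e1 e3; move: j1 j2; lra.
Qed.

End Recursions.

(** * Measurability and conditional expectation *)

Section MatrixMeasurability.
Context {R : realType} {N d : nat}.

(** Supplies the countable dense family for writing preimages as countable unions. *)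
Lemma rational_matrix_dense (X : 'M[R]_(N, d)) (e : R) : 0 < e ->
  exists q : 'M[rat]_(N, d), mnorm (X - map_mx ratr q) <= e.
Proof.
move=> e0; set s : R := Num.sqrt (N * d)%:R; have s0 : 0 <= s by exact: sqrtr_ge0.
have c0 : 0 < e / (s + 1) by rewrite divr_gt0// ltr_wpDl.
have /choice[q qP] : forall i, exists q : 'rV[rat]_d,
    forall j, `|X i j - ratr (q 0 j)| <= e / (s + 1).
  move=> i; have /choice[q qP] : forall j, exists q : rat, `|X i j - ratr q| <= e / (s + 1).
    move=> j; have [//|q] := @rat_in_itvoo R (X i j) (X i j + e / (s + 1)).
      by rewrite ltrDl.
    rewrite in_itv/= => /andP[h1 h2]; exists q; rewrite ler_norml; lra.
  by exists (\row_j q j) => j; rewrite mxE.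
exists (\matrix_(i, j) q i 0 j); apply: (le_trans (mnorm_le_norm _)).
have h : `|X - map_mx ratr (\matrix_(i, j) q i 0 j)| <= e / (s + 1).
  rewrite [leLHS]/Num.Def.normr/= mx_normrE; apply/bigmax_leP; split => [|[i j] _].
    exact: ltW.
  by rewrite !mxE.
apply: (le_trans (ler_wpM2l s0 h)).
by rewrite mulrCA ler_piMr// ?(ltW e0)// ler_pdivrMr ?ltr_wpDl//; lra.
Qed.

Context {d' : measure_display} {T : measurableType d'}.

Lemma measurable_mdot (X Y : T -> 'M[R]_(N, d)) :
  (forall i j, measurable_fun setT (fun w => X w i j)) ->
  (forall i j, measurable_fun setT (fun w => Y w i j)) ->
  measurable_fun setT (fun w => mdot (X w) (Y w)).
Proof.
move=> mX mY; apply: measurable_sum => i; apply: measurable_sum => j.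
exact: measurable_funM.
Qed.

Lemma measurable_mnorm (X : T -> 'M[R]_(N, d)) :
  (forall i j, measurable_fun setT (fun w => X w i j)) ->
  measurable_fun setT (fun w => mnorm (X w)).
Proof.
move=> mX; have ms : measurable_fun setT (@Num.sqrt R).
  by apply: continuous_measurable_fun; exact: sqrt_continuous.
exact: (measurableT_comp ms (measurable_mdot mX mX)).
Qed.

(* [phi] is the supremum of the functions [X |-> phi q - K |X - q|] over the
   rational matrices [q]. *)
Lemma measurable_lipschitz (phi : 'M[R]_(N, d) -> R) K (X : T -> 'M[R]_(N, d)) :
  0 <= K -> (forall Y Z, `|phi Y - phi Z| <= K * mnorm (Y - Z)) ->
  (forall i j, measurable_fun setT (fun w => X w i j)) ->
  measurable_fun setT (fun w => phi (X w)).
Proof.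
move=> K0 hphi mX mT; apply: (measurability _ (RGenOInfty.measurableE R)) => //.
move=> /= _ [_ [a ->] <-]; apply: measurableI => //; rewrite preimage_itvoy.
pose A (q : 'M[rat]_(N, d)) :=
  [set w | a < phi (map_mx ratr q) - K * mnorm (X w - map_mx ratr q)].
pose B n := if unpickle n is Some q then A q else set0.
have -> : [set w | a < phi (X w)] = \bigcup_n B n.
  apply/seteqP; split => [w /= aw|w [n _]]; last first.
    rewrite /B; case: unpickle => // q; rewrite /A /= => h.
    have := hphi (map_mx ratr q) (X w); rewrite ler_norml mnormBC; lra.
  have e0 : 0 < (phi (X w) - a) / (2 * K + 1).
    by rewrite divr_gt0 ?subr_gt0// ltr_wpDl// mulr_ge0.
  have [q qe] := rational_matrix_dense (X w) e0.
  exists (pickle q) => //; rewrite /B pickleK /A /=.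
  have := hphi (X w) (map_mx ratr q); rewrite ler_norml => /andP[_ h].
  move: qe h; set m := mnorm _ => qe h; have m0 : 0 <= m by exact: mnorm_ge0.
  have : m * (2 * K + 1) <= phi (X w) - a.
    by rewrite -ler_pdivlMr// ltr_wpDl// mulr_ge0.
  (* The choice of [e0] gives [2 K m + m <= phi (X w) - a]; strictness comes from [m > 0], and the
     case [m = 0] is separate. *)
  have : 2 * (K * m) < phi (X w) - a \/ 0 < m.
    have [->|mn] := eqVneq m 0; first by left; rewrite !mulr0 subr_gt0.
    by right; rewrite lt_neqAle eq_sym mn.
  by case; lra.
apply: bigcupT_measurable => n; rewrite /B; case: unpickle => [q|]; last exact: measurable0.
have mq : measurable_fun setT (fun w => phi (map_mx ratr q) - K * mnorm (X w - map_mx ratr q)).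
  apply: measurable_funB; first exact: measurable_cst.
  apply: measurable_funM; first exact: measurable_cst.
  apply: measurable_mnorm => i j.
  under eq_fun do rewrite mxE mxE.
  by apply: measurable_funB => //; exact: measurable_cst.
have := mq measurableT _ (measurable_itv `]a, +oo[).
by rewrite setTI preimage_itvoy.
Qed.

Lemma measurable_lipschitz_map (Phi : 'M[R]_(N, d) -> 'M[R]_(N, d)) K
    (X : T -> 'M[R]_(N, d)) :
  0 <= K -> (forall Y Z, mnorm (Phi Y - Phi Z) <= K * mnorm (Y - Z)) ->
  (forall i j, measurable_fun setT (fun w => X w i j)) ->
  forall i j, measurable_fun setT (fun w => Phi (X w) i j).
Proof.
move=> K0 hPhi mX i j.
apply: (@measurable_lipschitz (fun Y => Phi Y i j) K) => // Y Z.
apply: le_trans (hPhi Y Z); have := coord_le_mnorm (Phi Y - Phi Z) i j.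
by rewrite !mxE.
Qed.

End MatrixMeasurability.

Section Filtered.
Context {R : realType} {N d : nat} {dO : measure_display} {O : measurableType dO}.
Implicit Types (G : set (set O)) (X : O -> 'M[R]_(N, d)).

(** A sigma-algebra generates itself, so measurability with respect to [G] becomes measurability on
    a type, where the usual closure properties apply. *)
Lemma meas_wrtP G X : sigma_algebra setT G -> meas_wrt G X <->
  forall i j, measurable_fun (setT : set (g_sigma_algebraType G)) (fun w => X w i j).
Proof.
move=> sG; split => [h i j _ B mB|h i j B mB].
  by rewrite setTI measurable_g_measurableTypeE//; exact: h.
have := h i j measurableT B mB.
by rewrite setTI measurable_g_measurableTypeE.
Qed.

Lemma meas_wrt_measurable G X : G `<=` measurable -> meas_wrt G X ->
  forall i j, measurable_fun setT (fun w => X w i j).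
Proof. by move=> GM h i j _ B mB; rewrite setTI; apply/GM/h. Qed.

Lemma meas_wrt_sub G G' X : G `<=` G' -> meas_wrt G X -> meas_wrt G' X.
Proof. by move=> GG' h i j B mB; apply/GG'/h. Qed.

End Filtered.

(** * Centered variables and products with conditionally centered ones *)

Section Expectation.
Context {R : realType} {dO : measure_display} {O : measurableType dO} {P : probability O R}.
Implicit Types (Y Z : O -> R).

Definition centered Y :=
  P.-integrable setT (EFin \o Y) /\ (\int[P]_w (Y w)%:E = 0)%E.

Lemma centeredD Y Z : centered Y -> centered Z -> centered (fun w => Y w + Z w).
Proof.
move=> [iY Y0] [iZ Z0]; split; first exact: (integrableD measurableT iY iZ).
by under eq_integral do rewrite EFinD; rewrite integralD// Y0 Z0 adde0.
Qed.

Lemma centeredZ c Y : centered Y -> centered (fun w => c * Y w).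
Proof.
move=> [iY Y0]; split; first exact: (integrableZl measurableT c iY).
by under eq_integral do rewrite EFinM; rewrite integralZl// Y0 mule0.
Qed.

Lemma centered0 : centered (fun=> 0).
Proof. by split; [exact: integrable0 | rewrite integral0]. Qed.

Lemma centered_sum (I : Type) (r : seq I) (F : I -> O -> R) :
  (forall i, centered (F i)) -> centered (fun w => \sum_(i <- r) F i w).
Proof.
move=> hF; elim: r => [|i r IH].
  by under [X in centered X]eq_fun do rewrite big_nil; exact: centered0.
under [X in centered X]eq_fun do rewrite big_cons; exact: centeredD.
Qed.

Lemma centered_indic (G : set (set O)) (A : set O) Y : G `<=` measurable ->
  G A -> cond_mean_zero_real P G Y -> centered (fun w => \1_A w * Y w).
Proof.
move=> GM GA [iY Y0]; have mA := GM _ GA; split.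
  apply: (le_integrable measurableT _ _ iY) => [|w _] /=.
    apply/measurable_EFinP/measurable_funM; first exact: measurable_indic.
    by apply/measurable_EFinP; case/integrableP: iY.
  rewrite lee_fin normrM indicE; case: (w \in A); rewrite ?normr1 ?normr0 ?mul1r//.
  by rewrite mul0r.
rewrite -[RHS](Y0 _ GA) [RHS]integral_mkcond; apply: eq_integral => w _.
by rewrite patchE indicE; case: ifP => _; rewrite ?mul1r ?mul0r.
Qed.

(* [X] is approximated within [1 / (n + 1)] by the step function that takes
   the value [j / (n + 1) - M] on the set [A j]. *)
Lemma centered_mul (G : set (set O)) (M : R) (X Y : O -> R) : G `<=` measurable ->
  (forall B, measurable B -> G (X @^-1` B)) -> (forall w, `|X w| <= M) ->
  cond_mean_zero_real P G Y -> centered (fun w => X w * Y w).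
Proof.
move=> GM mX XM cY; have [iY _] := cY.
have mXT : measurable_fun setT X by move=> _ B mB; rewrite setTI; apply/GM/mX.
have mYT : measurable_fun setT Y by apply/measurable_EFinP; case/integrableP: iY.
have bounded_int c (U : O -> R) : measurable_fun setT U -> (forall w, `|U w| <= c) ->
    P.-integrable setT (EFin \o (fun w => U w * Y w)).
  move=> mU Uc; apply: (le_integrable measurableT _ _ (integrableZl measurableT c iY)).
    exact/measurable_EFinP/measurable_funM.
  move=> w _ /=; rewrite lee_fin !normrM ler_wpM2r//.
  exact: le_trans (Uc w) (ler_norm _).
have iXY : P.-integrable setT (EFin \o (fun w => X w * Y w)) by apply: bounded_int XM.
split=> //; apply/eqP; rewrite -abse_eq0 eq_le abse_ge0 andbT.
have fXY : (\int[P]_w (X w * Y w)%R%:E)%E \is a fin_num by exact: integrable_fin_num.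
have fY : (\int[P]_w `|(Y w)%:E|)%E \is a fin_num.
  by apply: integrable_fin_num => //; exact: integrable_abse iY.
rewrite -(fineK fXY) abse_EFin lee_fin.
apply: (@ler_addinv _ _ _ (fine ((\int[P]_w `|(Y w)%:E|)%E))) => n; rewrite add0r.
set h : R := n.+1%:R^-1; have h0 : 0 < h by rewrite invr_gt0 ltr0n.
pose A j := X @^-1` [set` `[j%:R * h - M, j.+1%:R * h - M[].
(* [X + M] takes values in [[0, 2 M]], covered by the cells of width [h] with index up to the
   truncation of [2 M / h]; hence the successor. *)
pose m := (Num.truncn ((M + M) / h)).+1.
pose Xn w := \sum_(j < m) (j%:R * h - M) * \1_(A j) w.
have XnX w : `|X w - Xn w| <= h.
  have Mw : 0 <= X w + M <= M + M by have := XM w; rewrite ler_norml; lra.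
  pose j := Num.truncn ((X w + M) / h).
  have jm : (j < m)%N.
    by rewrite ltnS /j; apply: le_truncn; rewrite ler_pM2r ?invr_gt0//; case/andP: Mw.
  have Xh0 : 0 <= (X w + M) / h by rewrite divr_ge0 ?(ltW h0)//; case/andP: Mw.
  have AE k : (w \in A k) = (j == k).
    rewrite /j truncn_eq// ler_pdivlMr// ltr_pdivrMr//; apply/idP/idP.
      by rewrite inE /A /= in_itv /= => /andP[? ?]; apply/andP; split; lra.
    by move=> /andP[? ?]; rewrite inE /A /= in_itv /=; apply/andP; split; lra.
  have -> : Xn w = j%:R * h - M.
    rewrite /Xn (bigD1 (Ordinal jm))//= indicE AE eqxx mulr1 big1 ?addr0//.
    move=> k kj; rewrite indicE AE; case: eqP => [jk|]; rewrite ?mulr0//.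
    by case/eqP: kj; apply: val_inj.
  have : w \in A j by rewrite AE.
  rewrite inE /A /= in_itv /= -natr1 => /andP[h1 h2].
  by rewrite ler_norml; apply/andP; split; lra.
have GA j : G (A j) by apply: mX; exact: measurable_itv.
have cXn : centered (fun w => Xn w * Y w).
  under [X in centered X]eq_fun do rewrite mulr_suml.
  apply: centered_sum => j; under [X in centered X]eq_fun do rewrite -mulrA.
  exact/centeredZ/(centered_indic GM).
have mXn : measurable_fun setT Xn.
  apply: measurable_sum => j; apply: measurable_funM; first exact: measurable_cst.
  exact/measurable_indic/GM.
have mD : measurable_fun setT (fun w => X w - Xn w) by exact: measurable_funB.
have iD := bounded_int _ _ mD XnX.
(* The step function contributes zero, so only the difference remains, which is at most [h] in
   absolute value; its integral is at most [h] times the mean of [|Y|]. *)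
have -> : (\int[P]_w (X w * Y w)%R%:E)%E = (\int[P]_w ((X w - Xn w) * Y w)%R%:E)%E.
  rewrite -[RHS]adde0 -(proj2 cXn) -integralD//; last by case: cXn.
  by apply: eq_integral => w _; rewrite -EFinD -mulrDl subrK.
have fD : (\int[P]_w ((X w - Xn w) * Y w)%R%:E)%E \is a fin_num by exact: integrable_fin_num.
rewrite -lee_fin EFinM -abse_EFin !fineK//.
apply: (le_trans (le_abse_integral _ measurableT _)); first by case/integrableP: iD.
rewrite muleC -ge0_integralZl//; last 2 first.
- by apply: measurableT_comp => //; exact/measurable_EFinP.
- by rewrite lee_fin ltW.
apply: ge0_le_integral => //.
- by apply: measurableT_comp => //; exact/measurable_EFinP/measurable_funM.
- apply: emeasurable_funM; first exact: measurable_cst.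
  by apply: measurableT_comp => //; exact/measurable_EFinP.
move=> w _; rewrite !abse_EFin -EFinM lee_fin normrM ler_wpM2r//.
Qed.

End Expectation.

(** * Mean square error after one noisy step *)

Section NoisyStep.
Context {R : realType} {N d : nat} {dO : measure_display} {O : measurableType dO}.
Implicit Types (G : set (set O)) (X : O -> 'M[R]_(N, d)).

Lemma meas_wrt_lipschitz G (Phi : 'M[R]_(N, d) -> 'M[R]_(N, d)) K X :
  sigma_algebra setT G -> 0 <= K ->
  (forall Y Z, mnorm (Phi Y - Phi Z) <= K * mnorm (Y - Z)) ->
  meas_wrt G X -> meas_wrt G (fun w => Phi (X w)).
Proof.
move=> sG K0 hPhi /(meas_wrtP _ sG) mX; apply/(meas_wrtP _ sG).
exact: measurable_lipschitz_map K0 hPhi mX.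
Qed.

Lemma meas_wrtD G X X' : sigma_algebra setT G -> meas_wrt G X -> meas_wrt G X' ->
  meas_wrt G (fun w => X w + X' w).
Proof.
move=> sG /(meas_wrtP _ sG) mX /(meas_wrtP _ sG) mX'; apply/(meas_wrtP _ sG) => i j.
under eq_fun do rewrite mxE; exact: measurable_funD.
Qed.

Lemma meas_wrtZ G c X : sigma_algebra setT G -> meas_wrt G X ->
  meas_wrt G (fun w => c *: X w).
Proof.
move=> sG /(meas_wrtP _ sG) mX; apply/(meas_wrtP _ sG) => i j.
under eq_fun do rewrite mxE.
by apply: measurable_funM => //; exact: measurable_cst.
Qed.

Lemma meas_wrtB G X X' : sigma_algebra setT G -> meas_wrt G X -> meas_wrt G X' ->
  meas_wrt G (fun w => X w - X' w).
Proof.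
move=> sG mX mX'; apply: meas_wrtD => //.
under [X in meas_wrt _ X]eq_fun do rewrite -scaleN1r.
exact: meas_wrtZ.
Qed.

Context {P : probability O R}.

Lemma Esq_le X X' : (forall i j, measurable_fun setT (fun w => X w i j)) ->
  (forall i j, measurable_fun setT (fun w => X' w i j)) ->
  (forall w, mnorm (X w) <= mnorm (X' w)) -> (Esq P X <= Esq P X')%E.
Proof.
move=> mX mX' h; apply: ge0_le_integral => //.
- by move=> w _; rewrite lee_fin sqr_ge0.
- exact/measurable_EFinP/measurable_funX/measurable_mnorm.
- exact/measurable_EFinP/measurable_funX/measurable_mnorm.
- by move=> w _; rewrite lee_fin lerXn2r ?nnegrE ?mnorm_ge0.
Qed.

Lemma Esq_scale c X : (forall i j, measurable_fun setT (fun w => X w i j)) ->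
  Esq P (fun w => c *: X w) = ((c ^+ 2)%:E * Esq P X)%E.
Proof.
move=> mX; rewrite /Esq -ge0_integralZl//.
- apply: eq_integral => w _; rewrite -EFinM; congr (_%:E).
  by rewrite mnormZ exprMn real_normK ?num_real.
- exact/measurable_EFinP/measurable_funX/measurable_mnorm.
- by move=> w _; rewrite lee_fin sqr_ge0.
- by rewrite lee_fin sqr_ge0.
Qed.

Lemma Esq_le_cst X b : (forall i j, measurable_fun setT (fun w => X w i j)) ->
  0 <= b -> (forall w, mnorm (X w) <= Num.sqrt N%:R * b) ->
  (Esq P X <= (N%:R * b ^+ 2)%:E)%E.
Proof.
move=> mX b0 h.
have -> : ((N%:R * b ^+ 2)%:E = \int[P]_(w in setT) (N%:R * b ^+ 2)%:E)%E.
  by rewrite integral_cst// [X in (_ * X)%E]probability_setT mule1.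
apply: ge0_le_integral => //.
- by move=> w _; rewrite lee_fin sqr_ge0.
- exact/measurable_EFinP/measurable_funX/measurable_mnorm.
- move=> w _; rewrite lee_fin -[N%:R]sqr_sqrtr ?ler0n// -exprMn.
  by rewrite lerXn2r ?nnegrE ?mnorm_ge0 ?mulr_ge0 ?sqrtr_ge0.
Qed.

Lemma Esq_noise_le G X S : (0 < N)%N -> sigma_algebra setT G ->
  (forall i j, measurable_fun setT (fun w => X w i j)) ->
  cond_mean_le P G (fun w => mnorm (X w) ^+ 2 / N%:R) S ->
  (Esq P X <= (N%:R * S)%:E)%E.
Proof.
move=> N0 [G0 GC _] mX hX.
have GT : G setT by rewrite -(setD0 setT); exact: GC.
have := hX _ GT; rewrite probability_setT mule1 => h.
have N0' : 0 < N%:R :> R by rewrite ltr0n.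
have -> : Esq P X = (N%:R%:E * \int[P]_w (mnorm (X w) ^+ 2 / N%:R)%:E)%E.
  rewrite -ge0_integralZl//.
  - apply: eq_integral => w _; rewrite -EFinM; congr (_%:E).
    by rewrite mulrC divfK// gt_eqF.
  - apply/measurable_EFinP/measurable_funM; last exact: measurable_cst.
    exact/measurable_funX/measurable_mnorm.
  - by move=> w _; rewrite lee_fin divr_ge0 ?sqr_ge0// ltW.
by rewrite EFinM lee_wpmul2l// lee_fin ltW.
Qed.

(** The squared norm of [A + gam e1 - eta e2] is [Z + C], with [Z] the three squares and [C] the
    cross terms. [C] is centered: [A] is bounded and measurable with respect to [G], and the two
    noises are uncorrelated. *)
Lemma noisy_step G (A e1 e2 D : O -> 'M[R]_(N, d)) M c gam eta S1 S2 :
  (0 < N)%N -> sigma_algebra setT G -> G `<=` measurable ->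
  meas_wrt G A -> (forall w, mnorm (A w) <= M) -> (Esq P A <= c%:E)%E ->
  (forall i j, measurable_fun setT (fun w => e1 w i j)) ->
  (forall i j, measurable_fun setT (fun w => e2 w i j)) ->
  (forall i j, measurable_fun setT (fun w => D w i j)) ->
  cond_mean_zero P G e1 -> cond_mean_zero P G e2 ->
  cond_mean_zero_real P G (fun w => mdot (e1 w) (e2 w)) ->
  cond_mean_le P G (fun w => mnorm (e1 w) ^+ 2 / N%:R) S1 ->
  cond_mean_le P G (fun w => mnorm (e2 w) ^+ 2 / N%:R) S2 ->
  (forall w, mnorm (D w) <= mnorm (A w + gam *: e1 w - eta *: e2 w)) ->
  (Esq P D <= (c + N%:R * (gam ^+ 2 * S1 + eta ^+ 2 * S2))%:E)%E.
Proof.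
move=> N0 sG GM mA AM Ac m1 m2 mD c1 c2 c12 v1 v2 hD.
have mAT := meas_wrt_measurable GM mA.
have GT : G setT by case: sG => G0 GC _; rewrite -(setD0 setT); exact: GC.
have cA (e : O -> 'M[R]_(N, d)) : cond_mean_zero P G e ->
    centered (P := P) (fun w => mdot (A w) (e w)).
  move=> ce; apply: centered_sum => i; apply: centered_sum => j.
  apply: (centered_mul GM (mA i j) _ (ce i j)) => w.
  exact: le_trans (coord_le_mnorm _ _ _) (AM w).
pose Z w := mdot (A w) (A w) + gam ^+ 2 * mdot (e1 w) (e1 w) + eta ^+ 2 * mdot (e2 w) (e2 w).
pose C w := 2 * gam * mdot (A w) (e1 w) + - (2 * eta) * mdot (A w) (e2 w)
            + - (2 * gam * eta) * mdot (e1 w) (e2 w).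
have cC : centered (P := P) C.
  apply: centeredD; last by apply: centeredZ; case: c12 => ? c12; split => //; exact: c12.
  by apply: centeredD; apply: centeredZ; exact: cA.
have mq (X : O -> 'M[R]_(N, d)) a : (forall i j, measurable_fun setT (fun w => X w i j)) ->
    measurable_fun setT (fun w => a * mdot (X w) (X w)).
  move=> mX; apply: measurable_funM; first exact: measurable_cst.
  exact: measurable_mdot.
have mZ : measurable_fun setT Z.
  apply: measurable_funD; last exact: mq.
  by apply: measurable_funD; [exact: measurable_mdot | exact: mq].
have Z0 w : 0 <= Z w.
  by rewrite /Z; apply: addr_ge0; [apply: addr_ge0|];
    rewrite ?mdot_ge0// mulr_ge0 ?sqr_ge0 ?mdot_ge0.
have EsqE (X : O -> 'M[R]_(N, d)) : Esq P X = (\int[P]_w (mdot (X w) (X w))%:E)%E.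
  by apply: eq_integral => w _; rewrite mnorm_sqr.
have q0 (X : O -> 'M[R]_(N, d)) a w : (0 <= (a ^+ 2 * mdot (X w) (X w))%:E)%E.
  by rewrite lee_fin mulr_ge0 ?sqr_ge0 ?mdot_ge0.
have qE (X : O -> 'M[R]_(N, d)) a : (forall i j, measurable_fun setT (fun w => X w i j)) ->
    (\int[P]_w (a ^+ 2 * mdot (X w) (X w))%:E = (a ^+ 2)%:E * Esq P X)%E.
  move=> mX; rewrite EsqE -ge0_integralZl//.
  - exact/measurable_EFinP/measurable_mdot.
  - by move=> w _; rewrite lee_fin mdot_ge0.
  - by rewrite lee_fin sqr_ge0.
have ZE : (\int[P]_w (Z w)%:E <= (c + N%:R * (gam ^+ 2 * S1 + eta ^+ 2 * S2))%:E)%E.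
  under eq_integral do rewrite !EFinD.
  have a0 w : setT w -> (0 <= (mdot (A w) (A w))%:E)%E by rewrite lee_fin mdot_ge0.
  have a1 w : setT w -> (0 <= (gam ^+ 2 * mdot (e1 w) (e1 w))%:E)%E by move=> _; exact: q0.
  have a2 w : setT w -> (0 <= (eta ^+ 2 * mdot (e2 w) (e2 w))%:E)%E by move=> _; exact: q0.
  have b0 := (measurable_EFinP _ _).2 (measurable_mdot mAT mAT).
  have b1 := (measurable_EFinP _ _).2 (mq _ (gam ^+ 2) m1).
  have b2 := (measurable_EFinP _ _).2 (mq _ (eta ^+ 2) m2).
  rewrite (ge0_integralD _ measurableT _ _ a2 b2); last 2 first.
  - by move=> w _; rewrite adde_ge0 ?a0 ?a1.
  - exact: emeasurable_funD.
  rewrite (ge0_integralD _ measurableT a0 b0 a1 b1).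
  rewrite !qE// -EsqE.
  have -> : c + N%:R * (gam ^+ 2 * S1 + eta ^+ 2 * S2) =
      c + gam ^+ 2 * (N%:R * S1) + eta ^+ 2 * (N%:R * S2) by ring.
  rewrite !EFinD !(EFinM (_ ^+ 2)); apply: leeD; first apply: leeD => //.
  - by apply: lee_wpmul2l; rewrite ?lee_fin ?sqr_ge0//; exact: Esq_noise_le v1.
  - by apply: lee_wpmul2l; rewrite ?lee_fin ?sqr_ge0//; exact: Esq_noise_le v2.
(* The finite bound on its integral makes [Z] integrable, as needed to split the integral of
   [Z + C]. *)
have iZ : P.-integrable setT (EFin \o Z).
  apply/integrableP; split; first exact/measurable_EFinP.
  under eq_integral do rewrite /= ger0_norm//.
  exact: le_lt_trans ZE (ltry _).
have mB i j : measurable_fun setT (fun w => (A w + gam *: e1 w - eta *: e2 w) i j).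
  under eq_fun do rewrite 5!mxE.
  apply: measurable_funB; last by apply: measurable_funM => //; exact: measurable_cst.
  apply: measurable_funD => //.
  by apply: measurable_funM => //; exact: measurable_cst.
apply: (le_trans (Esq_le mD mB hD)).
have -> : Esq P (fun w => A w + gam *: e1 w - eta *: e2 w) = (\int[P]_w (Z w)%:E)%E.
  rewrite -[RHS]adde0 -(proj2 cC) -integralD//; last by case: cC.
  rewrite EsqE; apply: eq_integral => w _; rewrite -EFinD; congr (_%:E).
  rewrite /Z /C !mdotE (mdotC (e1 w) (A w)) (mdotC (e2 w) (A w)) (mdotC (e2 w) (e1 w)).
  by ring.
exact: ZE.
Qed.

End NoisyStep.

(** * The three error estimates along the iterates *)

Theorem theorem2 (R : realType) (N d : nat) (hN : (2 <= N)%N) (hd : (1 <= d)%N)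
  (f : 'I_N -> 'rV[R]_d -> R) (g : 'I_N -> 'rV[R]_d -> 'rV[R]_d) (mu L : R)
  (hmu : 0 < mu) (hmuL : mu <= L)
  (hgrad : forall i, is_gradient (f i) (g i))
  (hsc : forall i, strongly_convex mu (f i) (g i))
  (hsm : forall i, smooth L (g i))
  (wstar : 'rV[R]_d)
  (hwstar : forall w, (\sum_(i < N) f i wstar) / N%:R <= (\sum_(i < N) f i w) / N%:R)
  (Wset : set 'rV[R]_d) (hWne : Wset !=set0) (hWcl : closed Wset)
  (hWcv : convexW_set Wset) (hWbd : boundedW_set Wset) (hWint : (Wset°) wstar)
  (zeta : R)
  (hzeta : (exists w, bdry Wset w /\ vnorm (w - wstar) = zeta) /\
           (forall w, bdry Wset w -> zeta <= vnorm (w - wstar)))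
  (hzeta_pos : 0 < zeta)
  (dm : R)
  (hdm : (exists w w', [/\ Wset w, Wset w' & vnorm (w - w') = dm]) /\
         (forall w w', Wset w -> Wset w' -> vnorm (w - w') <= dm))
  (Lap : 'M[R]_N) (hLap : laplacian Lap)
  (rho : seq R) (hrho : sorted_eigenvalues Lap rho) (hrho2 : 0 < rho`_1)
  (Pi : 'M[R]_(N, d) -> 'M[R]_(N, d)) (hPi : is_proj (setN Wset) Pi)
  (gam0 eta0 delta : R) (hgam0 : 0 < gam0) (heta0 : 0 < eta0)
  (hdelta : 0 < delta) (hdelta' : delta <= 4 / 5 * mu * eta0)
  (kbar : nat)
  (hk1 : forall k, (kbar <= k)%N ->
     sched eta0 delta (-1) k * (mu + L) + sched gam0 delta (- (3 / 4)) k * rho`_N.-1 <= 2)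
  (hk2 : forall k, (kbar <= k)%N ->
     sched eta0 delta (-1) k * (Num.sqrt N%:R * maxgrad g wstar * L)
       <= zeta * mu * rho`_1 * sched gam0 delta (- (3 / 4)) k)
  (Wst : nat -> 'M[R]_(N, d))
  (hWst : forall k, setN Wset (Wst k) /\
     (forall X, setN Wset X ->
        Gk f Lap (sched eta0 delta (-1) k) (sched gam0 delta (- (3 / 4)) k) (Wst k)
        <= Gk f Lap (sched eta0 delta (-1) k) (sched gam0 delta (- (3 / 4)) k) X))
  (dO : measure_display) (O : measurableType dO) (P : probability O R)
  (F : nat -> set (set O))
  (hFsig : forall k, sigma_algebra setT (F k))
  (hFmeas : forall k, F k `<=` measurable)
  (hFinc : forall k, F k `<=` F k.+1)
  (Sig1 Sig2 : R) (hSig1 : 0 <= Sig1) (hSig2 : 0 <= Sig2)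
  (eps1 eps2 : nat -> O -> 'M[R]_(N, d))
  (he_meas : forall k, meas_wrt (F k.+1) (eps1 k) /\ meas_wrt (F k.+1) (eps2 k))
  (he_mean : forall k, cond_mean_zero P (F k) (eps1 k) /\ cond_mean_zero P (F k) (eps2 k))
  (he_cross : forall k, cond_mean_zero_real P (F k) (fun w => mdot (eps1 k w) (eps2 k w)))
  (he_var1 : forall k, cond_mean_le P (F k) (fun w => (mnorm (eps1 k w)) ^+ 2 / N%:R) Sig1)
  (he_var2 : forall k, cond_mean_le P (F k) (fun w => (mnorm (eps2 k w)) ^+ 2 / N%:R) Sig2)
  (W Wbar : nat -> O -> 'M[R]_(N, d))
  (hWk0meas : meas_wrt (F kbar) (W kbar))
  (hWk0in : forall w, setN Wset (W kbar w))
  (hWrec : forall k w, (kbar <= k)%N ->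
     W k.+1 w = Pi (W k w
        - sched eta0 delta (-1) k *: gradGk g Lap (sched eta0 delta (-1) k)
                                      (sched gam0 delta (- (3 / 4)) k) (W k w)
        + sched gam0 delta (- (3 / 4)) k *: eps1 k w
        - sched eta0 delta (-1) k *: eps2 k w))
  (hWbar0 : Wbar kbar = W kbar)
  (hWbarrec : forall k w, (kbar <= k)%N ->
     Wbar k.+1 w = Pi (Wbar k w
        - sched eta0 delta (-1) k *: gradGk g Lap (sched eta0 delta (-1) k)
                                      (sched gam0 delta (- (3 / 4)) k) (Wbar k w))) :
  forall k, (kbar <= k)%N ->
  let s := 1 + delta * k%:R in
  let nab := maxgrad g wstar in
  [/\ (Esq P (fun w => (W k w - Wbar k w)%R)
        <= ((N%:R * (Num.sqrt 5 * expR 1 / (2 * Num.sqrt mu)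
              * (gam0 / Num.sqrt eta0 * Num.sqrt Sig1
                 + Num.sqrt (eta0 * Sig2) * s `^ (- (1 / 4)))
              * s `^ (- (1 / 4))) ^+ 2)%R)%:E)%E,
      (Esq P (fun w => (Wbar k w - Wst k)%R)
        <= ((N%:R * (dm * (1 + delta * (k%:R - kbar%:R) / (1 + delta * kbar%:R)) `^ (- (5 / 4))
              + nab * L / (mu * rho`_1) * (expR 1 / 4) * (eta0 / gam0)
                * (1 + L ^+ 2 / (mu * rho`_1) * (eta0 / gam0) * s `^ (- (1 / 4)))
                * s `^ (- (1 / 4))) ^+ 2)%R)%:E)%E
    & mnorm (Wst k - stack N wstar) / Num.sqrt N%:R
        <= nab * L / (mu * rho`_1) * (eta0 / gam0) * s `^ (- (1 / 4))].
Proof.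
have N0 : (0 < N)%N := ltnW hN.
have N0' : 0 < N%:R :> R by rewrite ltr0n.
have sN0 : 0 < Num.sqrt N%:R :> R by rewrite sqrtr_gt0.
have L0 : 0 < L := lt_le_trans hmu hmuL.
have rhoN := rho_last_gt0 hN hrho hrho2.
pose eta k := sched eta0 delta (-1) k.
pose gam k := sched gam0 delta (- (3 / 4)) k.
pose r := decay delta.
have r0 k : 0 < r k by exact: decay_gt0.
have etaE k : eta k = eta0 * r k ^+ 4 by exact: sched_inv.
have gamE k : gam k = gam0 * r k ^+ 3 by exact: sched_three_quarters.
have eta_gt0 k : 0 < eta k by rewrite etaE mulr_gt0 ?exprn_gt0.
have gam_gt0 k : 0 < gam k by rewrite gamE mulr_gt0 ?exprn_gt0.
pose a := eta0 / gam0.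
have a0 : 0 < a by rewrite divr_gt0.
have ratioE k : eta k / gam k = a * r k.
  by rewrite etaE gamE /a; field; rewrite !gt_eqF.
pose nab := maxgrad g wstar.
have nab0 : 0 <= nab by apply/bigmax_geP; left.
pose kap := L ^+ 2 / (mu * rho`_1).
have mr0 : 0 < mu * rho`_1 by rewrite mulr_gt0.
have kap0 : 0 <= kap by rewrite divr_ge0 ?sqr_ge0 ?ltW.
pose C := nab * L / (mu * rho`_1).
have C0 : 0 <= C by rewrite divr_ge0 ?(ltW mr0)// mulr_ge0// ltW.
have dm0 : 0 <= dm by case: hdm => -[w [w' [_ _ <-]]] _; exact: sqrtr_ge0.
have e2 : 2 <= expR 1 :> R.
  by have := expR_ge1Dx (1 : R); apply: le_trans; lra.
pose x k := delta * r k ^+ 4; pose z k := eta0 * r k ^+ 4 * mu.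
have xz k : 5 / 4 * x k <= z k.
  have := ler_wpM2r (exprn_ge0 4 (ltW (r0 k))) hdelta'.
  by rewrite /x /z; lra.
have x0 k : 0 <= x k by rewrite mulr_ge0 ?exprn_ge0 ?ltW.
(* Since [mu <= L], the stepsize condition gives [2 eta mu <= 2]. *)
have z1 k : (kbar <= k)%N -> z k <= 1.
  move=> /hk1; rewrite -/(eta k) -/(gam k) => h.
  have h1 : 0 <= gam k * rho`_N.-1 by rewrite mulr_ge0 ?ltW.
  have h2 := ler_wpM2l (ltW (eta_gt0 k)) hmuL.
  by rewrite /z -etaE; lra.
have rS k : r k.+1 <= r k by exact: decay_leS.
have rx k : r k * (1 - x k / 4) <= r k.+1 by exact: decay_geS.
have Wst0 k : (kbar <= k)%N -> gradGk g Lap (eta k) (gam k) (Wst k) = 0.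
  move=> kk; have [SW minW] := hWst k.
  apply: (constrained_minimizer_zero hmu hmuL hsc hsm hN hLap hrho hrho2
    (eta_gt0 k) (gam_gt0 k) hwstar hWcl (interior_subset hWint) (proj2 hzeta)) => //.
  (* The bound on the stepsize ratio, with denominators cleared, says that the distance to consensus
     is at most [zeta]. *)
  have := hk2 _ kk; rewrite -/(eta k) -/(gam k) -/nab => h.
  rewrite -/nab.
  have -> : Num.sqrt N%:R * (nab * L / (mu * rho`_1) * (eta k / gam k)) =
      eta k * (Num.sqrt N%:R * nab * L) / (mu * rho`_1 * gam k).
    by field; rewrite !gt_eqF.
  have g0 : 0 < mu * rho`_1 * gam k by rewrite mulr_gt0.
  by rewrite (ler_pdivrMr _ _ g0); lra.
pose T k X := X - eta k *: gradGk g Lap (eta k) (gam k) X.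
have Tlip k X Y : (kbar <= k)%N -> mnorm (T k X - T k Y) <= (1 - z k) * mnorm (X - Y).
  move=> kk; rewrite /z -etaE.
  apply: (gradient_map_contraction hmu hmuL hsc hsm hN hLap hrho hrho2) => //.
  exact: hk1.
have Pi1 X Y : mnorm (Pi X - Pi Y) <= 1 * mnorm (X - Y).
  by rewrite mul1r; exact: (proj_nonexpansive hWcv hPi).
have Piin X : setN Wset (Pi X) by case: (hPi X).
(* The induction starts where [k] meets [kbar]. The step map and [Pi] are Lipschitz, hence preserve
   measurability, and the noise of step [k] belongs to [F k.+1]. *)
have mWk k : (kbar <= k)%N -> meas_wrt (F k) (W k) /\ forall w, setN Wset (W k w).
  elim: k => [|k IH]; first by rewrite leqn0 => /eqP kb0; move: hWk0meas hWk0in; rewrite kb0.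
  rewrite leq_eqVlt => /orP[/eqP <-//|kk]; have [mW inW] := IH kk.
  split=> [|w]; last by rewrite hWrec.
  have sF := hFsig k.+1.
  under [X in meas_wrt _ X]eq_fun do rewrite hWrec//.
  apply: (meas_wrt_lipschitz sF ler01 Pi1).
  have [m1 m2] := he_meas k.
  apply: meas_wrtB => //; last exact: meas_wrtZ.
  apply: meas_wrtD => //; last exact: meas_wrtZ.
  apply: (meas_wrt_lipschitz sF (K := 1 - z k) (Phi := T k)).
  - by rewrite subr_ge0 z1.
  - by move=> ? ?; exact: Tlip.
  - exact: meas_wrt_sub (hFinc k) mW.
have mWbark k : (kbar <= k)%N -> meas_wrt (F k) (Wbar k) /\ forall w, setN Wset (Wbar k w).
  elim: k => [|k IH].
    by rewrite leqn0 => /eqP kb0; move: hWk0meas hWk0in; rewrite -hWbar0 kb0.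
  rewrite leq_eqVlt => /orP[/eqP <-|kk]; first by rewrite hWbar0.
  have [mW inW] := IH kk.
  split=> [|w]; last by rewrite hWbarrec.
  have sF := hFsig k.+1.
  under [X in meas_wrt _ X]eq_fun do rewrite hWbarrec//.
  apply: (meas_wrt_lipschitz sF ler01 Pi1).
  apply: (meas_wrt_lipschitz sF (K := 1 - z k) (Phi := T k)).
  - by rewrite subr_ge0 z1.
  - by move=> ? ?; exact: Tlip.
  - exact: meas_wrt_sub (hFinc k) mW.
have mT k (X : O -> 'M[R]_(N, d)) : meas_wrt (F k) X ->
    forall i j, measurable_fun setT (fun w => X w i j).
  exact: meas_wrt_measurable (hFmeas k).
have diam (X Y : 'M[R]_(N, d)) : setN Wset X -> setN Wset Y -> mnorm (X - Y) <= Num.sqrt N%:R * dm.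
  move=> SX SY; apply: mnorm_rows => // i; rewrite linearB /=.
  exact: (proj2 hdm).
pose b k := dm * (r k / r kbar) ^+ 5 + C * (expR 1 / 4) * a * (1 + kap * a * r k) * r k.
have lag0 k : 0 <= C * (expR 1 / 4) * a * (1 + kap * a * r k) * r k.
  apply: mulr_ge0; last exact: ltW.
  apply: mulr_ge0; last by rewrite addr_ge0// mulr_ge0 ?(ltW (r0 k))// mulr_ge0// ltW.
  by apply: mulr_ge0; [rewrite mulr_ge0// divr_ge0// expR_ge0 | exact: ltW].
have b0 k : 0 <= b k.
  by apply: addr_ge0 => //; rewrite mulr_ge0// exprn_ge0// divr_ge0 ?(ltW (r0 _)).
(* The bound holds for every outcome; taking the mean square comes last. At [kbar] the transient
   term equals [dm] and covers the initial distance. *)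
have track k w : (kbar <= k)%N -> mnorm (Wbar k w - Wst k) <= Num.sqrt N%:R * b k.
  have base : mnorm (Wbar kbar w - Wst kbar) <= Num.sqrt N%:R * b kbar.
    apply: (le_trans (diam _ _ _ _)); rewrite ?hWbar0//; first by case: (hWst kbar).
    by rewrite ler_pM2l// /b divff ?gt_eqF// expr1n mulr1 lerDl.
  elim: k => [|k IH]; first by rewrite leqn0 => /eqP kb0; move: base; rewrite kb0.
  rewrite leq_eqVlt => /orP[/eqP <-//|kk].
  have {}IH := IH kk; have kk1 := leqW kk.
  have drift := penalized_minimizer_drift hmu hmuL hsc hsm hN hLap hrho hrho2
    (eta_gt0 k.+1) (gam_gt0 k.+1) (eta_gt0 k) (gam_gt0 k) hwstar (Wst0 _ kk1) (Wst0 _ kk).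
  rewrite !ratioE -/nab -/C -/kap in drift.
  have contr : mnorm (Wbar k.+1 w - Wst k) <= (1 - z k) * mnorm (Wbar k w - Wst k).
    (* The minimizer is feasible with vanishing gradient, so it is fixed by the projected step. *)
    have TW : Pi (T k (Wst k)) = Wst k.
      rewrite /T Wst0// scaler0 subr0.
      by apply: (proj_id hPi); case: (hWst k).
    rewrite hWbarrec// -{1}TW; apply: (le_trans (Pi1 _ _)); rewrite mul1r.
    exact: Tlip.
  have sE (q s : R) : (q / Num.sqrt N%:R <= s) = (q <= Num.sqrt N%:R * s).
    by rewrite ler_pdivrMr// mulrC.
  rewrite -sE.
  apply: (tracking_step (xz k) (z1 _ kk) (x0 k) (r0 k) (r0 k.+1) (rS k) (rx k) e2 dm0 C0
    (ltW a0) kap0 (r0 kbar) (a := mnorm (Wbar k w - Wst k) / Num.sqrt N%:R)).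
    rewrite sE mulrDr.
    have -> : Num.sqrt N%:R * ((1 - z k) * (mnorm (Wbar k w - Wst k) / Num.sqrt N%:R)) =
        (1 - z k) * mnorm (Wbar k w - Wst k) by field; rewrite gt_eqF.
    apply: (le_trans (mnorm_tri _ (Wst k) _)); apply: lerD => //.
    by rewrite mnormBC.
  by rewrite sE.
pose K2 : R := 5 * expR 1 ^+ 2 / (4 * mu).
have K20 : 0 <= K2 by rewrite divr_ge0 ?mulr_ge0 ?sqr_ge0 ?(ltW hmu).
(* A bound on the mean square error per agent in which the two noise sources add as squares; this is
   what the recursion preserves. *)
pose v k := K2 * (gam0 ^+ 2 / eta0 * Sig1 * r k ^+ 2 + eta0 * Sig2 * r k ^+ 4).
have v0 k : 0 <= v k.
  by rewrite mulr_ge0// addr_ge0// !mulr_ge0 ?invr_ge0 ?exprn_ge0 ?(ltW heta0)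
    ?(ltW hgam0) ?(ltW (r0 k)).
have noise k : (kbar <= k)%N -> (Esq P (fun w => W k w - Wbar k w)%R <= (N%:R * v k)%:E)%E.
  have base : (Esq P (fun w => W kbar w - Wbar kbar w)%R <= (N%:R * v kbar)%:E)%E.
    rewrite hWbar0 /Esq.
    under eq_integral do rewrite subrr mnorm_sqr mdot0l.
    by rewrite integral0 lee_fin mulr_ge0// ltW.
  elim: k => [|k IH]; first by rewrite leqn0 => /eqP kb0; move: base; rewrite kb0.
  rewrite leq_eqVlt => /orP[/eqP <-//|kk].
  have {}IH := IH kk; have kk1 := leqW kk.
  have [mW inW] := mWk _ kk; have [mWb inWb] := mWbark _ kk.
  have [mW' _] := mWk _ kk1; have [mWb' _] := mWbark _ kk1.
  have zc0 : 0 <= 1 - z k by rewrite subr_ge0 z1.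
  have mTX X : meas_wrt (F k) X -> meas_wrt (F k) (fun w => T k (X w)).
    by apply: (meas_wrt_lipschitz (hFsig k) zc0) => ? ?; exact: Tlip.
  have mD : meas_wrt (F k) (fun w => W k w - Wbar k w) by exact: meas_wrtB.
  have mA : meas_wrt (F k) (fun w => T k (W k w) - T k (Wbar k w)).
    by apply: meas_wrtB => //; exact: mTX.
  (* The bounded diameter gives the uniform bound that makes the products with the noise
     integrable. *)
  have AM w : mnorm (T k (W k w) - T k (Wbar k w)) <= (1 - z k) * (Num.sqrt N%:R * dm).
    by apply: (le_trans (Tlip _ _ _ kk)); rewrite ler_wpM2l// diam.
  have EA : (Esq P (fun w => T k (W k w) - T k (Wbar k w))%R
      <= ((1 - z k) ^+ 2 * (N%:R * v k))%:E)%E.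
    apply: (@le_trans _ _ (Esq P (fun w => (1 - z k) *: (W k w - Wbar k w))%R)).
      apply: Esq_le.
      - exact: mT mA.
      - exact/mT/(meas_wrtZ _ (hFsig k)).
      - by move=> w; rewrite mnormZ ger0_norm// Tlip.
    rewrite Esq_scale; last exact: mT mD.
    by rewrite [leRHS]EFinM; apply: lee_wpmul2l; rewrite ?lee_fin ?sqr_ge0.
  have [m1 m2] := he_meas k; have [c1 c2] := he_mean k.
  have mD' := meas_wrtB (hFsig _) mW' mWb'.
  have step := noisy_step (gam := gam k) (eta := eta k) N0 (hFsig k) (hFmeas k) mA AM EA
    (mT _ _ m1) (mT _ _ m2) (mT _ _ mD') c1 c2 (he_cross k) (he_var1 k) (he_var2 k).
  apply: (le_trans (step _)).
    move=> w; rewrite hWrec// hWbarrec//; apply: (le_trans (Pi1 _ _)); rewrite mul1r.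
    rewrite le_eqVlt; apply/orP; left; apply/eqP; congr mnorm.
    rewrite -/(eta k) -/(gam k) /T; move: (gradGk _ _ _ _ _) (gradGk _ _ _ _ _) => ? ?.
    by mxring.
  rewrite lee_fin (mulrCA (_ ^+ 2)) -mulrDr ler_pM2l//.
  apply: (noise_step (xz k) (z1 _ kk) (x0 k) (r0 k) (r0 k.+1) (rx k) e2 hmu heta0 hSig1 hSig2
    erefl _ (lexx _)).
  by rewrite etaE gamE.
move=> k kk s nab'; rewrite -/nab in nab' *.
have sE : s `^ (- (1 / 4)) = r k by [].
split.
- apply: (le_trans (noise k kk)); rewrite lee_fin ler_pM2l// sE.
  rewrite /v /K2 !exprMn exprVn !exprMn !sqr_sqrtr ?(ltW hmu)//.
  set u := gam0 / Num.sqrt eta0 * Num.sqrt Sig1.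
  set t := Num.sqrt (eta0 * Sig2).
  have uE : gam0 ^+ 2 / eta0 * Sig1 = u ^+ 2.
    by rewrite /u !exprMn exprVn !sqr_sqrtr// ltW.
  have tE : eta0 * Sig2 = t ^+ 2 by rewrite sqr_sqrtr// mulr_ge0// ltW.
  have u0 : 0 <= u by rewrite !mulr_ge0 ?invr_ge0 ?sqrtr_ge0// ltW.
  have t0 : 0 <= t by exact: sqrtr_ge0.
  have -> : (2 : R) ^+ 2 = 4 by ring.
  rewrite uE tE -[leRHS]mulrA ler_wpM2l//.
  (* The stated bound squares the sum [u + t r]; it exceeds [v] by a multiple of this nonnegative
     cross term. *)
  have ut0 : 0 <= u * t * r k ^+ 3.
    by apply: mulr_ge0; [exact: mulr_ge0 | exact: exprn_ge0 (ltW (r0 k))].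
  move: ut0; lra.
- have [mW _] := mWbark _ kk.
  rewrite decay_ratio5// -/r sE -/C -/kap -/a.
  apply: Esq_le_cst => //.
  + move=> i j; under eq_fun do rewrite !mxE.
    by apply: measurable_funB; [exact: mT mW i j | exact: measurable_cst].
  + exact: b0.
  + by move=> w; exact: track.
rewrite ler_pdivrMr// mulrC sE -/C -/a -mulrA -ratioE.
exact: (penalized_minimizer_dist hmu hmuL hsc hsm hN hLap hrho hrho2 _ _ hwstar (Wst0 _ kk)).
Qed.
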